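(* Let $H$ be a real Hilbert space, $F:H\to H$, $y\in H$ with $F(y)=0$, and let $R,M_1,M_2,m_1>0$. For $u_0\in H$ write $B(u_0,R):=\{u\in H:\|u-u_0\|\le R\}$. Let $\tilde A:=F'(y)$. There exists $\eta>0$ such that the following holds for every $u_0\in H$ and every bounded linear operator $Q_0$ on $H$ satisfying: - $y\in B(u_0,R)$; - $F$ has Fréchet derivatives $F',F''$ on $B(u_0,R)$ with $\sup_{u\in B(u_0,R)}\|F^{(j)}(u)\|\le M_j$, $j=1,2$; - $F'(u)$ is boundedly invertible for $u\in B(u_0,R)$ and $\sup_{u\in B(u_0,R)}\|[F'(u)]^{-1}\|\le m_1$; - $\|u_0-y\|\le\eta$ and $\|Q_0-\tilde A^{-1}\|\le\eta$ (that is, $u_0$ and $Q_0$ are sufficiently close to $y$ and $\tilde A^{-1}$, respectively). The Cauchy problem $$\dot u=-QF(u),\quad u(0)=u_0,\qquad \dot Q=-TQ+A^*,\quad Q(0)=Q_0,$$ where $A:=F'(u(t))$, $T:=A^*A$, and $Q=Q(t)$ is a bounded linear operator on $H$, has a unique global solution $(u(t),Q(t))$, $t\ge0$; the limit $u(\infty):=\lim_{t\to\infty}u(t)$ exists, $F(u(\infty))=0$, and $u(t)$ converges to $y$, which solves $F(u)=0$, exponentially fast as $t\to\infty$.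
   Context: $A^*$ denotes the adjoint operator, $\dot u=du/dt$, $\dot Q=dQ/dt$. Converging exponentially fast means $\|u(t)-y\|\le Ce^{-\gamma t}$ for all $t\ge 0$ with some constants $C,\gamma>0$. *)

(* Defs.v *)
From HB Require Import structures.
From mathcomp Require Import all_boot all_order all_algebra.
From mathcomp Require Import sesquilinear.
From mathcomp Require Import all_classical all_reals all_analysis.

Set Implicit Arguments.
Unset Strict Implicit.
Unset Printing Implicit Defensive.

Import Order.TTheory GRing.Theory Num.Theory.
Import numFieldNormedType.Exports.

Local Open Scope classical_set_scope.
Local Open Scope ring_scope.

Section BoundedOperator.
Context {R : realType} (V W : normedModType R).

Definition bounded_linear : {pred V -> W} :=
  mem [set f : V -> W | linear f /\ exists M : R, forall x, `|f x| <= M * `|x|].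

Record bop := Bop { bop_fun :> V -> W; bopP : bop_fun \in bounded_linear }.

HB.instance Definition _ := [isSub for bop_fun].
HB.instance Definition _ := [Choice of bop by <:].

Lemma bounded_linear_submod_closed : submod_closed bounded_linear.
Proof.
split.
  rewrite inE /=; split; first by move=> a u v; rewrite scaler0 addr0.
  by exists 0 => x; rewrite normr0 mul0r.
move=> a f g /[!inE] -[fl [M fM]] [gl [N gN]].
have afgE x : (a *: f + g) x = a *: f x + g x by [].
split.
  move=> b u v; rewrite !afgE fl gl !scalerDr !scalerA [b * a]mulrC.
  by rewrite addrACA.
exists (`|a| * M + N) => x; rewrite afgE mulrDl (le_trans (ler_normD _ _))//.
by rewrite lerD// normrZ -mulrA ler_wpM2l.
Qed.

HB.instance Definition _ :=
  GRing.isSubmodClosed.Build R (V -> W) bounded_linear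
    bounded_linear_submod_closed.
HB.instance Definition _ := [SubChoice_isSubLmodule of bop by <:].

Lemma bop_linear (L : bop) : linear L.
Proof. by have /[!inE] -[] := bopP L. Qed.

HB.instance Definition _ (L : bop) :=
  GRing.isLinear.Build R V W *:%R L (bop_linear L).

Definition opnorm (L : bop) : R :=
  sup [set `|L x| | x in [set x : V | `|x| <= 1]].

Lemma opnorm_has_sup (L : bop) :
  has_sup [set `|L x| | x in [set x : V | `|x| <= 1]].
Proof.
split; first by exists `|L 0|; exists 0; rewrite //= normr0.
have /[!inE] -[_ [M LM]] := bopP L.
exists `|M| => _ [x /= x1 <-]; rewrite (le_trans (LM x))//.
rewrite (le_trans (ler_wpM2r (normr_ge0 x) (ler_norm M)))//.
by rewrite ler_piMr.
Qed.

Lemma ler_opnorm1 (L : bop) (x : V) : `|x| <= 1 -> `|L x| <= opnorm L.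
Proof. by move=> x1; apply: (sup_upper_bound (opnorm_has_sup L)); exists x. Qed.

Lemma opnorm_le (L : bop) (M : R) :
  (forall x, `|x| <= 1 -> `|L x| <= M) -> opnorm L <= M.
Proof.
move=> LM; apply: ge_sup; first by case: (opnorm_has_sup L).
by move=> _ [x x1 <-]; exact: LM.
Qed.

Lemma opnorm_ge0 (L : bop) : 0 <= opnorm L.
Proof. by rewrite (le_trans _ (@ler_opnorm1 L 0 _)) ?normr0. Qed.

Lemma ler_opnormD (L M : bop) : opnorm (L + M) <= opnorm L + opnorm M.
Proof.
apply: opnorm_le => x x1; rewrite (le_trans (ler_normD (L x) (M x)))//.
by rewrite lerD// ler_opnorm1.
Qed.

Lemma opnormZ (a : R) (L : bop) : opnorm (a *: L) = `|a| * opnorm L.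
Proof.
have le_Z b (K : bop) : opnorm (b *: K) <= `|b| * opnorm K.
  apply: opnorm_le => x x1; rewrite [X in `|X|]/(b *: K x) normrZ.
  by rewrite ler_wpM2l// ler_opnorm1.
apply/eqP; rewrite eq_le le_Z /=; have [->|a0] := eqVneq a 0.
  by rewrite normr0 mul0r opnorm_ge0.
rewrite -ler_pdivlMl ?normr_gt0// -normfV (le_trans _ (le_Z _ _))//.
by rewrite scalerA mulVf// scale1r.
Qed.

Lemma opnorm0_eq0 (L : bop) : opnorm L = 0 -> L = 0.
Proof.
move=> L0; apply/val_inj/funext => x /=.
have [->|x0] := eqVneq x 0; first by rewrite linear0.
have := @ler_opnorm1 L (`|x|^-1 *: x).
rewrite normrZ normfV normr_id mulVf ?normr_eq0// => /(_ (lexx _)).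
rewrite linearZ /= normrZ normfV normr_id L0 pmulr_rle0 ?invr_gt0 ?normr_gt0//.
by rewrite normr_le0 => /eqP.
Qed.

HB.instance Definition _ :=
  Lmodule_isNormed.Build R bop ler_opnormD opnormZ opnorm0_eq0.

(* [f] as an operator; the junk value 0 when [f] is not bounded linear *)
Definition to_bop (f : V -> W) : bop := insubd (0 : bop) f.

End BoundedOperator.

Notation "''B' ( V , W )" := (bop V W)
  (at level 8, format "''B' ( V ,  W )") : type_scope.
Notation "''B' ( V )" := (bop V V)
  (at level 8, format "''B' ( V )") : type_scope.

Section Operators.
Context {R : realType}.

Lemma bop_comp_subproof (U V W : normedModType R) (L : 'B(V, W)) (K : 'B(U, V)) :
  L \o K \in bounded_linear (V := U) (W := W).
Proof.
have /[!inE] -[Ll [M LM]] := bopP L; have /[!inE] -[Kl [N KN]] := bopP K.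
split; first by move=> a u v; rewrite /= Kl Ll.
exists (`|M| * N) => x /=; rewrite (le_trans (LM _))//.
rewrite (le_trans (ler_wpM2r (normr_ge0 _) (ler_norm M)))//.
by rewrite -mulrA ler_wpM2l.
Qed.

Definition bop_comp (U V W : normedModType R) (L : 'B(V, W)) (K : 'B(U, V)) :
  'B(U, W) := Bop (bop_comp_subproof L K).

Definition is_inverse (V W : normedModType R) (L : 'B(V, W)) (K : 'B(W, V)) :=
  cancel L K /\ cancel K L.

Definition boundedly_invertible (V W : normedModType R) (L : 'B(V, W)) :=
  exists K, is_inverse L K.

(* only meaningful when [L] is boundedly invertible *)
Definition bop_inv (V W : normedModType R) (L : 'B(V, W)) : 'B(W, V) :=
  xget 0 [set K | is_inverse L K].

(* On a Hilbert space the Riesz theorem provides a unique such operator, so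
   that the default value 0 is never used. *)
Definition adjoint (H : normedModType R) (dot : {dot H for idfun})
    (A : 'B(H)) : 'B(H) :=
  xget 0 [set B : 'B(H) | forall x z, dot (A x) z = dot x (B z)].

Definition fderiv (V W : normedModType R) (f : V -> W) (u : V) : 'B(V, W) :=
  to_bop ('d f u).

(* Derivative at [u] relative to [D], for functions that are only meaningful on
   [D]: increments are taken along points of [D]. On a ball of positive radius
   it is unique, and at interior points it is [fderiv f u]. *)
Definition fderiv_within (V W : normedModType R) (D : set V) (f : V -> W)
  (u : V) : 'B(V, W) := to_bop ('d f (within D (nbhs u))).

Definition differentiable_within (V W : normedModType R) (D : set V)
  (f : V -> W) (u : V) : Prop := differentiable f (within D (nbhs u)).

(* [f'(t) = v] for a function on the half-line [0, +oo[: the derivative at 0 is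
   one-sided, and the values of [f] at negative reals are irrelevant *)
Definition is_tderiv (V : normedModType R) (f : R -> V) (t : R) (v : V) : Prop :=
  (s - t)^-1 *: (f s - f t) @[s --> within [set s | 0 <= s] t^'] --> v.

Definition cball (V : normedModType R) (u0 : V) (r : R) : set V :=
  [set u | `|u - u0| <= r].

Definition cauchy_solution (H : normedModType R) (dot : {dot H for idfun})
    (F : H -> H) (u0 : H) (Q0 : 'B(H)) (u : R -> H) (Q : R -> 'B(H)) : Prop :=
  [/\ u 0 = u0, Q 0 = Q0 &
    forall t : R, 0 <= t ->
      let A := fderiv F (u t) in
      let T := bop_comp (adjoint dot A) A in
      [/\ differentiable F (u t),
          is_tderiv u t (- Q t (F (u t))) &
          is_tderiv Q t (- bop_comp T (Q t) + adjoint dot A)]].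

Definition exp_cvg (V : normedModType R) (u : R -> V) (y : V) : Prop :=
  exists C gamma : R, [/\ 0 < C, 0 < gamma &
    forall t : R, 0 <= t -> `|u t - y| <= C * expR (- gamma * t)].

End Operators.

(* Main.v *)
Require Import Defs.
From HB Require Import structures.
From mathcomp Require Import all_boot all_order all_algebra.
From mathcomp Require Import sesquilinear.
From mathcomp Require Import all_classical all_reals all_analysis.
From mathcomp Require Import ring lra.

Set Implicit Arguments.
Unset Strict Implicit.
Unset Printing Implicit Defensive.

Import Order.TTheory GRing.Theory Num.Theory.
Import numFieldNormedType.Exports.

Local Open Scope classical_set_scope.
Local Open Scope ring_scope.

(** Write [w = u - y], [J = F'(y)^-1] and [V = Q - J]. As [F y = 0], Taylor's
    formula gives [F u = F'(y) w + O(|w|^2)], so the first equation reads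
    [w' = - w - V (F u) + O(|w|^2)]: when [|V|] and [|w|] are small, [|w|]
    decreases at rate at least 1/2. With [A = F'(u)] and [At] its adjoint, the
    second equation reads [V' = - At A V + At (F'(y) - A) J]. Since
    [|A x| >= |x| / m1], the operator [At A] is bounded below by [1 / m1^2], and
    the forcing term is at most [M1 M2 m1 |w|], so [|V|] cannot leave a small
    ball as long as [|w|] is small enough compared to its radius. The set [S] of
    all pairs [(u, Q)] with [|w| <= rho] and [|V| <= delta], for well-chosen
    [rho] and [delta], is therefore invariant, and [|w|] decays exponentially
    on it.

    All these estimates are made on one explicit Euler step
    ([newton_step_contracts], [inverse_step_estimate]), not on the flow: every
    small enough step maps [S] into itself and shrinks [|w|]. On [S] the vector
    field is bounded and Lipschitz ([newton_field_lipschitz]; the derivative is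
    Lipschitz by a mean value inequality, [frechet_lipschitz]). Under these
    hypotheses the Euler polygons with steps [h0 / 2^n] converge for every time
    ([polygon_limit]), and the limit [x] satisfies
    [|x s - x t - (s - t) f (x t)| <= C (s - t)^2], so that it solves the
    equation. Invariance and decay pass to the limit: existence is global from
    the start, and neither integrals nor a continuation argument occur. The
    limit lives in the product of [H] with its bounded operators, whence the
    need for completeness of the latter ([bop_complete], [prod_complete]).

    Nothing keeps another solution in [S], or even in the ball, beforehand. But
    the difference of two solutions is fenced by a small multiple of
    [exp ((L + 1) t)], and as long as it is below the fence, the other solution
    stays in a neighbourhood of [S] on which the field is [L]-Lipschitz
    ([norm_fence], [ode_unique]). The existence of adjoints is Riesz's theorem
    ([riesz_representation]). *)

(** * Bounded operators and completeness *)

Lemma subACA (V : zmodType) (a b c d : V) : a - b - (c - d) = a - c - (b - d).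
Proof. by rewrite opprD addrACA -opprD. Qed.

Section BoundedOperators.
Context {R : realType}.

Lemma bop_norm_le (V W : normedModType R) (L : 'B(V, W)) (x : V) :
  `|L x| <= `|L| * `|x|.
Proof.
have [->|x0] := eqVneq x 0; first by rewrite linear0 !normr0 mulr0.
have x_gt0 : 0 < `|x| by rewrite normr_gt0.
have := @ler_opnorm1 _ _ _ L (`|x|^-1 *: x).
rewrite linearZ /= !normrZ normfV normr_id mulVf ?gt_eqF// => /(_ (lexx _)).
by rewrite mulrC ler_pdivrMr.
Qed.

Lemma bop_le_norm (V W : normedModType R) (L : 'B(V, W)) (M : R) :
  0 <= M -> (forall x, `|L x| <= M * `|x|) -> `|L| <= M.
Proof.
move=> M0 LM; apply: opnorm_le => x x1.
by rewrite (le_trans (LM x))// ler_piMr.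
Qed.

Lemma bopBE (V W : normedModType R) (L K : 'B(V, W)) (x : V) :
  (L - K) x = L x - K x.
Proof. by []. Qed.

Lemma bop_linearB (V W : normedModType R) (L : 'B(V, W)) x z :
  L (x - z) = L x - L z.
Proof. exact: linearB. Qed.

Lemma bop_comp_norm (U V W : normedModType R) (L : 'B(V, W)) (K : 'B(U, V)) :
  `|bop_comp L K| <= `|L| * `|K|.
Proof.
apply: bop_le_norm; first by rewrite mulr_ge0.
move=> x; rewrite -mulrA (le_trans (bop_norm_le L (K x)))// ler_wpM2l//.
exact: bop_norm_le.
Qed.

Lemma bop_ext (V W : normedModType R) (L K : 'B(V, W)) :
  (forall x, L x = K x) -> L = K.
Proof. by move=> LK; apply/val_inj/funext. Qed.

Lemma bop_invP (V W : normedModType R) (L : 'B(V, W)) :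
  boundedly_invertible L -> is_inverse L (bop_inv L).
Proof.
by move=> [K LK]; apply: (@xgetPex _ 0 [set K | is_inverse L K]); exists K.
Qed.

(** A Cauchy filter of operators converges pointwise. The pointwise limit is at
    distance at most 1 from some operator, hence bounded, and the Cauchy
    estimates, being uniform on the unit ball, turn pointwise convergence into
    convergence in norm. *)
Lemma bop_complete (V : normedModType R) (W : completeNormedModType R)
  (F : set_system 'B(V, W)) : ProperFilter F -> cauchy F -> cvg F.
Proof.
move=> FF Fc.
have Fd e : 0 < e -> exists L, F [set K : 'B(V, W) | `|L - K| < e].
  move=> e0; have /cauchyP := Fc.
  move=> /(_ _ e0) [L]; rewrite -ball_normE.
  by exists L.
pose ev x := fun L : 'B(V, W) => L x.
have cx x : cvg (ev x @ F).
  apply/cauchy_cvgP/cauchy_exP => e e0.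
  have [L FL] := Fd (e / (`|x| + 1)) ltac:(by rewrite divr_gt0// ltr_wpDl).
  exists (L x); rewrite -ball_normE.
  change (F [set K : 'B(V, W) | `|L x - K x| < e]).
  apply: filterS FL => K /= LK.
  rewrite -bopBE (le_lt_trans (bop_norm_le _ _))//.
  rewrite ltr_pdivlMr ?ltr_wpDl// in LK.
  by rewrite (le_lt_trans _ LK)// ler_wpM2l// lerDl.
pose l x := lim (ev x @ F).
have lP x : ev x @ F --> l x by exact: cx.
have l_lin : linear l.
  move=> a u v.
  have lauv : a *: ev u L + ev v L @[L --> F] --> a *: l u + l v.
    by apply: cvgD; [apply: cvgZr|]; exact: lP.
  apply: (cvg_unique (@norm_hausdorff _ W) (lP _)).
  apply: cvg_trans lauv; apply: near_eq_cvg.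
  by apply: nearW => L; rewrite /ev bop_linear.
have lD L e : F [set K : 'B(V, W) | `|L - K| < e] ->
    forall x, `|L x - l x| <= e * `|x|.
  move=> FL x.
  have : `|L x - ev x K| @[K --> F] --> `|L x - l x|.
    by apply: cvg_norm; apply: cvgB; [exact: cvg_cst|exact: lP].
  move=> /cvgr_to_le; apply.
  apply: filterS FL => K /= /ltW LK.
  by rewrite -bopBE (le_trans (bop_norm_le _ _))// ler_wpM2r.
have l_bnd : l \in bounded_linear (V := V) (W := W).
  rewrite inE /=; split=> //.
  have [L0 /lD L0l] := Fd 1 ltr01.
  exists (1 + `|L0|) => x.
  rewrite -[l x](subrK (L0 x)) (le_trans (ler_normD _ _))//.
  by rewrite mulrDl lerD ?bop_norm_le// distrC L0l.
apply/cvg_ex; exists (Bop l_bnd).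
apply/cvgrPdist_le => e e0.
have [L FL] := Fd (e / 2) ltac:(by rewrite divr_gt0).
apply: filterS (FL) => K /= /ltW LK.
rewrite -(subrKA L) (splitr e) (le_trans (ler_normD _ _))// lerD//.
apply: bop_le_norm; first by rewrite divr_ge0// ltW.
by move=> x; rewrite bopBE distrC; exact: lD.
Qed.

HB.instance Definition _ (V : normedModType R) (W : completeNormedModType R) :=
  Uniform_isComplete.Build 'B(V, W) (@bop_complete V W).

Lemma prod_complete (V W : completeNormedModType R)
  (F : set_system [the normedModType R of (V * W)%type]) :
  ProperFilter F -> cauchy F -> cvg F.
Proof.
move=> FF /cauchyP Fc.
have Fn (e : R) : 0 < e ->
    exists x : V * W, F [set z | `|x.1 - z.1| < e /\ `|x.2 - z.2| < e].
  move=> /Fc[x]; rewrite -ball_normE => Fx; exists x.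
  by apply: filterS Fx => z /=; rewrite prod_normE gt_max => /andP.
pose p1 (z : V * W) := z.1; pose p2 (z : V * W) := z.2.
have c1 : cvg (p1 @ F).
  apply/cauchy_cvgP/cauchy_exP => e e0; have [x Fx] := Fn e e0.
  exists x.1; rewrite -ball_normE.
  change (F [set z : V * W | `|x.1 - z.1| < e]).
  by apply: filterS Fx => z [].
have c2 : cvg (p2 @ F).
  apply/cauchy_cvgP/cauchy_exP => e e0; have [x Fx] := Fn e e0.
  exists x.2; rewrite -ball_normE.
  change (F [set z : V * W | `|x.2 - z.2| < e]).
  by apply: filterS Fx => z [].
apply/cvg_ex; exists (lim (p1 @ F), lim (p2 @ F)).
have c := cvg_pair c1 c2.
by move=> A /c; rewrite nbhs_simpl /=; apply: filterS => -[].
Qed.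

HB.instance Definition _ (V W : completeNormedModType R) :=
  Uniform_isComplete.Build (V * W)%type (@prod_complete V W).

End BoundedOperators.

(** * Growth bounds for vector-valued functions *)

Section GrowthBounds.
Context {R : realType}.

(** A substitute for compactness of [[0, T]]: the supremum of the initial
    segments on which [P] holds satisfies [P] by the closure hypothesis, and
    would not be an upper bound by the forward hypothesis if it were less than
    [T]. *)
Lemma real_induction (T : R) (P : R -> Prop) :
  P 0 ->
  (forall t, 0 <= t < T -> P t ->
     exists2 d, 0 < d & forall s, t < s < t + d -> s <= T -> P s) ->
  (forall t, 0 < t <= T -> (forall s, 0 <= s < t -> P s) -> P t) ->
  forall t, 0 <= t <= T -> P t.
Proof.
move=> P0 Pfwd Pcl t0 /andP[t00 t0T].
have T0 : 0 <= T by exact: le_trans t0T.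
pose E := [set t : R | 0 <= t <= T /\ forall s, 0 <= s <= t -> P s].
have E0 : E 0.
  split; first by rewrite lexx.
  move=> s /andP[s0 s0']; rewrite (_ : s = 0)//.
  by apply/eqP; rewrite eq_le s0 s0'.
have supE : has_sup E.
  by split; [exists 0|exists T => x [/andP[]]].
set c := sup E.
have c0 : 0 <= c by exact: sup_upper_bound.
have cT : c <= T by apply: ge_sup; [exists 0|move=> x [/andP[]]].
have Plt s : 0 <= s < c -> P s.
  move=> /andP[s0 sc].
  have [x [_ Ex] sx] : exists2 x, E x & s < x.
    have [x Ex] := @sup_adherent _ E (c - s) ltac:(by rewrite subr_gt0) supE.
    by rewrite subKr => sx; exists x.
  by apply: Ex; rewrite s0 ltW.
have Pc : P c.
  have [->//|c_neq0] := eqVneq c 0.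
  by apply: Pcl => //; rewrite lt_neqAle eq_sym c_neq0 c0.
have [ltcT|leTc] := ltP c T; last first.
  have [t0c|] := boolP (0 <= t0 < c); first exact: Plt.
  rewrite t00 /= -leNgt => ct0.
  by rewrite (_ : t0 = c)//; apply/eqP; rewrite eq_le ct0 (le_trans t0T).
have [d d0 Pd] := Pfwd c ltac:(by rewrite c0) Pc.
pose h := Num.min (d / 2) (T - c).
have h0 : 0 < h by rewrite lt_min divr_gt0//= subr_gt0.
have hd : h < d by rewrite gt_min ltr_pdivrMr// ltr_pMr// ltr1n.
have hT : c + h <= T by rewrite -lerBrDl ge_min lexx orbT.
suff /(sup_upper_bound supE) : E (c + h) by rewrite gerDl leNgt h0.
split; first by rewrite addr_ge0// ltW.
move=> s /andP[s0 sch]; have [sc|cs|->//] := ltgtP s c.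
  by apply: Plt; rewrite s0.
by apply: Pd; [rewrite cs (le_lt_trans sch)// ltrD2l|exact: le_trans hT].
Qed.

Section Tangent.
Context {V : normedModType R}.

(** Differentiability at [t] along [D] in epsilon-delta form: unlike a limit of
    difference quotients, it needs no case distinction at the endpoints of [D]
    nor at [s = t]. *)
Definition tangent_within (D : set R) (e : R -> V) (t : R) (v : V) :=
  forall eps, 0 < eps -> exists2 d, 0 < d & forall s, D s -> `|s - t| < d ->
    `|e s - e t - (s - t) *: v| <= eps * `|s - t|.

(** A curve cannot cross a fence [psi] which, wherever the curve is below it,
    grows strictly faster than the speed of the curve. Both the mean value
    inequality (linear fence) and Gronwall's uniqueness argument (exponential
    fence) are instances. The speed is only evaluated at points below the fence,
    which makes it possible to use estimates that hold near a reference curve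
    only. *)
Lemma norm_fence (T : R) (e de : R -> V) (psi : R -> R) :
  (forall t, 0 <= t <= T -> tangent_within [set s | 0 <= s <= T] e t (de t)) ->
  {in [pred t | 0 <= t <= T] &, {homo psi : s t / s <= t}} ->
  `|e 0| <= psi 0 ->
  (forall t, 0 <= t < T -> `|e t| <= psi t -> exists2 eps, 0 < eps &
     forall s, t < s <= T -> psi t + (s - t) * (`|de t| + eps) <= psi s) ->
  forall t, 0 <= t <= T -> `|e t| <= psi t.
Proof.
move=> edE psi_homo e0 step; apply: real_induction => //.
- move=> t /andP[t0 tT] et.
  have [eps eps0 psis] := step t ltac:(by rewrite t0) et.
  have [d d0 ed] := edE t ltac:(by rewrite t0 ltW) eps eps0.
  exists d => // s /andP[ts std] sT.
  have st0 : 0 < s - t by rewrite subr_gt0.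
  have := psis s ltac:(by rewrite ts); apply: le_trans.
  have := ed s; rewrite /= (ltW (le_lt_trans t0 ts)) sT gtr0_norm//.
  move=> /(_ isT); rewrite ltrBlDl => /(_ std) es.
  have -> : e s = e t + ((s - t) *: de t + (e s - e t - (s - t) *: de t)).
    by rewrite [X in _ + X]addrC subrK addrC subrK.
  rewrite (le_trans (ler_normD _ _))// lerD// (le_trans (ler_normD _ _))//.
  by rewrite mulrDr lerD// ?normrZ ?gtr0_norm// mulrC.
- move=> t /andP[t0 tT] lt_t; apply/ler_addgt0Pl => eps eps0.
  have [d d0 ed] := edE t ltac:(by rewrite ltW) 1 ltr01.
  pose N := 1 + `|de t|.
  have N0 : 0 < N by rewrite ltr_wpDr.
  (* The curve moves by at most [N * h <= eps] between [t - h] and [t]. *)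
  pose h := Num.min t (Num.min (d / 2) (eps / N)).
  have h0 : 0 < h by rewrite !lt_min t0 !divr_gt0.
  have hd : h < d.
    by rewrite !gt_min [X in _ || (X || _)]ltr_pdivrMr// ltr_pMr// ltr1n orbT.
  have ht : h <= t by rewrite ge_min lexx.
  have hN : N * h <= eps.
    by rewrite mulrC -ler_pdivlMr// /h !ge_min lexx !orbT.
  pose s := t - h.
  have st : s - t = - h by rewrite /s; ring.
  have s0 : 0 <= s by rewrite subr_ge0.
  have lst : s < t by rewrite /s ltrBlDr ltrDl.
  have sT : s <= T by rewrite (le_trans (ltW lst)).
  have := ed s; rewrite /= s0 sT st normrN gtr0_norm// mul1r => /(_ isT hd) es.
  have ps : psi s <= psi t.
    by apply: psi_homo; rewrite ?inE ?s0 ?sT ?(ltW t0) ?tT ?(ltW lst).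
  have es' := lt_t s ltac:(by rewrite s0).
  have -> : e t = e s + (h *: de t - (e s - e t - - h *: de t)).
    rewrite scaleNr opprK opprD [X in _ + X]addrCA subrr addr0 opprB.
    by rewrite addrC subrK.
  rewrite (le_trans (ler_normD _ _))// addrC lerD ?(le_trans es')//.
  rewrite (le_trans (ler_normB _ _))// (le_trans _ hN)// /N mulrDl mul1r addrC.
  by rewrite lerD// normrZ gtr0_norm// mulrC.
Qed.

Lemma mean_value_norm (T K : R) (e de : R -> V) : 0 <= T ->
  (forall t, 0 <= t <= T -> tangent_within [set s | 0 <= s <= T] e t (de t)) ->
  (forall t, 0 <= t <= T -> `|de t| <= K) ->
  `|e T - e 0| <= K * T.
Proof.
move=> T0 edE deK; apply/ler_addgt0Pl => eps eps0.
have K0 : 0 <= K by rewrite (le_trans _ (deK 0 _))// lexx.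
pose k := K + eps / (T + 1).
have T1 : 0 < T + 1 by rewrite ltr_wpDl.
have k0 : 0 < eps / (T + 1) by rewrite divr_gt0.
have kT : k * T <= eps + K * T.
  rewrite /k mulrDl addrC lerD2r -mulrA ler_piMr ?(ltW eps0)//.
  by rewrite mulrC ler_pdivrMr// mul1r lerDl.
apply: le_trans kT.
apply: (@norm_fence T (fun t => e t - e 0) de (fun t => k * t)); last first.
- by rewrite lexx T0.
- move=> t /andP[t0 tT] _; exists (eps / (T + 1)) => // s /andP[ts sT].
  rewrite -lerBrDl -mulrBr mulrC ler_wpM2r// ?subr_ge0 ?(ltW ts)// lerD2r.
  by apply: deK; rewrite t0 ltW.
- by rewrite subrr normr0 mulr0.
- by move=> s t _ _ st; rewrite ler_wpM2l// addr_ge0// ltW.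
- move=> t tT e1 e10; have [d d0 ed] := edE t tT e1 e10.
  exists d => // s sT st.
  rewrite (_ : e s - e 0 - _ = e s - e t); first exact: ed.
  by rewrite opprB addrA subrK.
Qed.

End Tangent.

Definition frechet_within (V W : normedModType R) (D : set V) (f : V -> W)
    (u : V) (L : 'B(V, W)) :=
  forall eps, 0 < eps -> exists2 d, 0 < d & forall v, D v -> `|v - u| < d ->
    `|f v - f u - L (v - u)| <= eps * `|v - u|.

Definition segment_closed (V : normedModType R) (D : set V) :=
  forall a b, D a -> D b -> forall t, 0 <= t <= 1 -> D (a + t *: (b - a)).

Lemma cball_segment_closed (V : normedModType R) (a : V) r :
  segment_closed (cball a r).
Proof.
rewrite /cball => u v /= ur vr t /andP[t0 t1].
have -> : u + t *: (v - u) - a = (1 - t) *: (u - a) + t *: (v - a).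
  rewrite scalerBl scale1r -[RHS]addrA [X in _ = _ + X]addrC -scalerBr.
  by rewrite opprB addrA subrK addrAC.
rewrite (le_trans (ler_normD _ _))// !normrZ (ger0_norm t0).
rewrite ger0_norm ?subr_ge0//.
have -> : r = (1 - t) * r + t * r by ring.
by rewrite lerD// ler_wpM2l// subr_ge0.
Qed.

(** The mean value inequality along the segment from [a] to [b], which never
    leaves [D]. Derivatives relative to [D] suffice, which matters for [F'],
    whose derivative is only given along a closed ball. *)
Lemma frechet_lipschitz (V W : normedModType R) (D : set V) (f : V -> W)
    (df : V -> 'B(V, W)) (K : R) : segment_closed D ->
  (forall u, D u -> frechet_within D f u (df u)) ->
  (forall u, D u -> `|df u| <= K) ->
  forall a b, D a -> D b -> `|f b - f a| <= K * `|b - a|.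
Proof.
move=> Dseg fdf dfK a b Da Db.
pose g (t : R) := a + t *: (b - a).
have Dg t : 0 <= t <= 1 -> D (g t) by exact: Dseg.
have gB s t : g s - g t = (s - t) *: (b - a).
  by rewrite /g opprD addrACA subrr add0r -scalerBl.
have -> : a = g 0 by rewrite /g scale0r addr0.
have -> : b = g 1 by rewrite /g scale1r addrC subrK.
rewrite gB subr0 scale1r -[leRHS]mulr1.
apply: (@mean_value_norm W 1 _ (f \o g) (fun t => df (g t) (b - a))) => //.
- move=> t t01 eps eps0.
  have n0 : 0 < `|b - a| + 1 by rewrite ltr_wpDl.
  have eps'0 : 0 < eps / (`|b - a| + 1) by rewrite divr_gt0.
  have [d d0 fd] := fdf _ (Dg t t01) _ eps'0.
  exists (d / (`|b - a| + 1)); first by rewrite divr_gt0.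
  move=> s s01 st.
  have := fd (g s) (Dg s s01); rewrite gB linearZ /= normrZ => fgs.
  rewrite (le_trans (fgs _))//.
    rewrite (le_lt_trans _ (_ : `|s - t| * (`|b - a| + 1) < d))//.
      by rewrite ler_wpM2l// lerDl.
    by rewrite -ltr_pdivlMr.
  rewrite -mulrA ler_wpM2l ?(ltW eps0)// mulrCA ler_piMr//.
  by rewrite mulrC ler_pdivrMr// mul1r lerDl.
- move=> t t01; rewrite (le_trans (bop_norm_le _ _))// ler_wpM2r//.
  by apply: dfK; exact: Dg.
Qed.

Lemma diff_bounded (V W : normedModType R) (F : filter_on V) (f : V -> W) :
  differentiable f F -> ('d f F : V -> W) \in bounded_linear (V := V) (W := W).
Proof.
move=> dfF; rewrite inE /=; split; first exact: linearP.
have dc : {for 0, continuous 'd f F} by exact: diff_continuous dfF 0.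
have /linear_boundedP fb := @continuous_linear_bounded _ _ _ 0 _ dc.
have [M fM] : exists M, forall x, `|'d f F x| <= M * `|x|.
  by near (+oo_R) => M; exists M; near: M.
by exists M.
Unshelve. all: by end_near. Qed.

(** The differential along an arbitrary filter, with the operator produced by
    [to_bop]: continuity of the differential ensures that [to_bop] does not
    return its default value. *)
Lemma diff_littleo (V W : normedModType R) (F : filter_on V) (f : V -> W)
    (u : V) (eps : R) : lim F = u -> differentiable f F -> 0 < eps ->
  nbhs F [set x | `|f x - f u - to_bop ('d f F) (x - u)| <= eps * `|x - u|].
Proof.
move=> limF dfF eps0.
have -> : to_bop ('d f F) = 'd f F :> (V -> W).
  by rewrite /to_bop; rewrite [LHS](insubdK _ (diff_bounded dfF)).
case: dfF => -[_ /eqaddoP /(_ eps eps0)]; rewrite limF.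
apply: filterS => x /=; rewrite opprD addrA. 
by [].
Qed.

Lemma fderiv_frechet (V W : normedModType R) (f : V -> W) (u : V) :
  differentiable f u -> frechet_within setT f u (fderiv f u).
Proof.
move=> dfu eps eps0.
have limu := lim_id (@norm_hausdorff _ V) u.
have := @diff_littleo V W (nbhs_filter_on u) f u eps limu dfu eps0.
move=> /nbhs_ballP[d /= d0 ud]; exists d => // v _ vu; apply: ud.
by rewrite -ball_normE /= distrC.
Qed.

Lemma fderiv_within_frechet (V W : normedModType R) (D : set V) (f : V -> W)
    (u : V) : D u -> differentiable_within D f u ->
  frechet_within D f u (fderiv_within D f u).
Proof.
move=> Du dfu eps eps0.
have pF : ProperFilter (within D (nbhs u)).
  exact: (@within_nbhs_proper _ D u (subset_closure Du)).
have limF : lim (within D (nbhs u)) = u.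
  apply: (cvg_unique (@norm_hausdorff _ V) _ (@cvg_within _ _ _ D)).
  by apply: (cvgP u); exact: cvg_within.
have := diff_littleo limF dfu eps0.
move=> /nbhs_ballP[d /= d0 ud]; exists d => // v Dv vu; apply: ud => //.
by rewrite -ball_normE /= distrC.
Qed.

End GrowthBounds.

(** * Convergence of Euler polygons *)

Section EulerPolygons.
Context {R : realType}.

(** The increments form an absolutely convergent series. *)
Lemma geometric_increments_cvg (X : completeNormedModType R) (x : nat -> X)
  (C : R) : (forall n, `|x n.+1 - x n| <= C * 2^-1 ^+ n) -> cvg (x @ \oo).
Proof.
move=> xC.
have C0 : 0 <= C.
  by have := le_trans (normr_ge0 _) (xC 0%N); rewrite expr0 mulr1.
have : cvg (series (telescope x) @ \oo).
  apply: normed_cvg; apply: (@series_le_cvg R _ (geometric C (2^-1))).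
  - by move=> n /=.
  - by move=> n /=; rewrite mulr_ge0// exprn_ge0// invr_ge0.
  - by move=> n /=; exact: xC.
  - apply: is_cvg_geometric_series.
    by rewrite normfV ger0_norm// invf_lt1// ltr1n.
move=> cx; rewrite (_ : x = series (telescope x) + cst (x 0%N)).
  by apply: is_cvgD => //; exact: is_cvg_cst.
by apply/funext => n; rewrite fctE telescopeK subrK.
Qed.

Section Steps.
Variables (X : normedModType R) (f : X -> X).

Definition euler (h : R) (k : nat) (x : X) : X :=
  iter k (fun z => z + h *: f z) x.

Variables (S : set X) (L M h0 : R).
Hypothesis S_step : forall x h, S x -> 0 < h <= h0 -> S (x + h *: f x).
Hypothesis f_lip : forall x z, S x -> S z -> `|f x - f z| <= L * `|x - z|.
Hypothesis f_bnd : forall x, S x -> `|f x| <= M.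
Hypotheses (L0 : 0 <= L) (M0 : 0 <= M).

Lemma euler_in h k x : 0 < h <= h0 -> S x -> S (euler h k x).
Proof. by move=> hh Sx; elim: k => [//|k Sk]; exact: S_step. Qed.

Lemma euler_dist h k x : 0 < h <= h0 -> S x ->
  `|euler h k x - x| <= M * (k%:R * h).
Proof.
move=> hh Sx; elim: k => [|k IH] /=; first by rewrite subrr normr0 mul0r mulr0.
have /andP[hpos _] := hh.
rewrite -/(euler h k x) addrAC (le_trans (ler_normD _ _))//.
have -> : M * (k.+1%:R * h) = M * (k%:R * h) + h * M by rewrite -natr1; ring.
rewrite lerD// normrZ gtr0_norm// ler_wpM2l ?(ltW hpos)//.
by apply: f_bnd; exact: euler_in.
Qed.

(** Each of the [k] steps deviates from the initial direction by [h] times the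
    variation of [f] since the start, which is at most [L * M * (k * h)]. *)
Lemma euler_tangent h k x : 0 < h <= h0 -> S x ->
  `|euler h k x - x - (k%:R * h) *: f x| <= L * M * (k%:R * h) ^+ 2.
Proof.
move=> hh Sx; elim: k => [|k IH] /=.
  by rewrite !mul0r scale0r subr0 subrr normr0 expr0n mulr0.
have /andP[hpos _] := hh.
rewrite -/(euler h k x); set z := euler h k x in IH *.
have -> : z + h *: f z - x - (k.+1%:R * h) *: f x =
          (z - x - (k%:R * h) *: f x) + h *: (f z - f x).
  rewrite -natr1 mulrDl mul1r scalerDl scalerBr opprD addrA.
  rewrite -!addrA; congr (_ + _); rewrite addrCA; congr (_ + _).
  by rewrite addrCA.
rewrite (le_trans (ler_normD _ _))// (le_trans (lerD IH (lexx _)))//.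
rewrite normrZ gtr0_norm//.
have fzx : `|f z - f x| <= L * (M * (k%:R * h)).
  rewrite (le_trans (f_lip _ Sx))//; first exact: euler_in.
  by rewrite ler_wpM2l//; exact: euler_dist.
have kh : 0 <= L * M * ((k%:R + 1) * h ^+ 2).
  by rewrite !mulr_ge0// ?addr_ge0// ltW.
rewrite (le_trans (lerD (lexx _) (ler_wpM2l (ltW hpos) fzx)))//.
rewrite -natr1 -subr_ge0.
by have -> : L * M * ((k%:R + 1) * h) ^+ 2 -
  (L * M * (k%:R * h) ^+ 2 + h * (L * (M * (k%:R * h)))) =
  L * M * ((k%:R + 1) * h ^+ 2) by ring.
Qed.

(** Discrete Gronwall inequality. Halving the step makes an error of at most
    [L * M * h ^+ 2] on each full step, and a full step expands distances by
    [1 + L * h]; summing the geometric progression gives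
    [M * h * ((1 + L * h) ^+ k - 1)]. *)
Lemma euler_halve h k x : 0 < h <= h0 -> S x ->
  `|euler (h / 2) k.*2 x - euler h k x| <= M * h * expR (L * (k%:R * h)).
Proof.
move=> hh Sx; have /andP[hpos hh0] := hh.
have h2 : 0 < h / 2 <= h0.
  by rewrite divr_gt0//= (le_trans _ hh0)// ler_pdivrMr// ler_peMr ?ltW// ltr1n.
have le_exp : (1 + L * h) ^+ k <= expR (L * (k%:R * h)).
  rewrite mulrCA expRM_natl lerXn2r ?nnegrE ?expR_ge0 ?expR_ge1Dx//.
  by rewrite addr_ge0// mulr_ge0// ltW.
have Mh : 0 <= M * h by rewrite mulr_ge0// ltW.
apply: (@le_trans _ _ (M * h * ((1 + L * h) ^+ k - 1))); last first.
  by rewrite ler_wpM2l// lerBlDr (le_trans le_exp)// lerDl.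
elim: k {le_exp} => [|k IH] /=; first by rewrite subrr normr0 expr0 subrr mulr0.
rewrite -/(euler (h / 2) k.*2 x) -/(euler h k x).
have Sa := @euler_in (h / 2) k.*2 x h2 Sx; have Sb := @euler_in h k x hh Sx.
set a := euler (h / 2) k.*2 x in IH Sa *; set b := euler h k x in IH Sb *.
set a' := a + (h / 2) *: f a.
have Sa' : S a' by exact: S_step.
have aa' : a' + (h / 2) *: f a' - (a + h *: f a) = (h / 2) *: (f a' - f a).
  rewrite [in h *: f a](splitr h) scalerDl [a + (_ + _)]addrA opprD addrACA.
  by rewrite subrr add0r scalerBr.
have ab : a + h *: f a - (b + h *: f b) = (a - b) + h *: (f a - f b).
  by rewrite opprD addrACA -scalerBr.
have le1 : `|(h / 2) *: (f a' - f a)| <= M * L * h ^+ 2.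
  have /andP[h2pos _] := h2.
  rewrite normrZ gtr0_norm//.
  rewrite (le_trans (ler_wpM2l (ltW h2pos) (f_lip Sa' Sa)))//.
  rewrite /a' addrAC subrr add0r normrZ gtr0_norm//.
  apply: (@le_trans _ _ (h / 2 * (L * (h / 2 * M)))).
    by rewrite !ler_wpM2l ?(ltW h2pos)// f_bnd.
  rewrite -subr_ge0 (_ : _ - _ = (3 / 4) * (M * L * h ^+ 2)); last by field.
  by rewrite mulr_ge0// mulr_ge0 ?sqr_ge0// mulr_ge0.
have le2 : `|(a - b) + h *: (f a - f b)| <= (1 + L * h) * `|a - b|.
  rewrite (le_trans (ler_normD _ _))// mulrDl mul1r lerD2l normrZ gtr0_norm//.
  by rewrite [L * h]mulrC -mulrA ler_wpM2l ?(ltW hpos)// f_lip.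
rewrite (le_trans (ler_distD (a + h *: f a) _ _))// aa' ab.
have lh : 0 <= 1 + L * h by rewrite addr_ge0// mulr_ge0// ltW.
rewrite (le_trans (lerD le1 (le_trans le2 (ler_wpM2l lh IH))))//.
rewrite [in leRHS]exprS.
move: ((1 + L * h) ^+ k) => p.
by rewrite le_eqVlt; apply/orP; left; apply/eqP; ring.
Qed.

End Steps.

Section Limit.
Variables (X : completeNormedModType R) (f : X -> X).
Variables (S : set X) (L M h0 : R).
Hypothesis S_closed : closed S.
Hypothesis S_step : forall x h, S x -> 0 < h <= h0 -> S (x + h *: f x).
Hypothesis f_lip : forall x z, S x -> S z -> `|f x - f z| <= L * `|x - z|.
Hypothesis f_bnd : forall x, S x -> `|f x| <= M.
Hypotheses (L0 : 0 <= L) (M0 : 0 <= M) (h0_gt0 : 0 < h0).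

Let step n := h0 * 2^-1 ^+ n.

Let step_itv n : 0 < step n <= h0.
Proof.
rewrite /step mulr_gt0 ?exprn_gt0 ?invr_gt0//= ler_piMr ?(ltW h0_gt0)//.
by rewrite exprn_ile1// ?invr_ge0// invf_le1// ler1n.
Qed.

Let step_gt0 n : 0 < step n. Proof. by have /andP[] := step_itv n. Qed.

Let step_cvg0 : step n @[n --> \oo] --> 0.
Proof.
rewrite -[X in _ --> X](mulr0 h0); apply: cvgMr.
by apply: cvg_expr; rewrite normfV ger0_norm// invf_lt1// ltr1n.
Qed.

(** The Euler polygon with [n] times halved step, read at the last node before
    [t]: a step function suffices, since consecutive nodes are at most [M * h]
    apart. *)
Definition polygon n (x : X) (t : R) : X :=
  euler f (h0 * 2^-1 ^+ n) (Num.truncn (t / (h0 * 2^-1 ^+ n))) x.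

Let truncn_step n t : 0 <= t ->
  let k := Num.truncn (t / step n) in k%:R * step n <= t < (k%:R + 1) * step n.
Proof.
move=> t0; rewrite /=; set k := Num.truncn _.
have tn0 : 0 <= t / step n by rewrite divr_ge0// ltW.
have /andP[] := truncn_itv tn0.
by rewrite ler_pdivlMr// ltr_pdivrMr// -/k natr1 => -> ->.
Qed.

Lemma polygon_in n x t : S x -> S (polygon n x t).
Proof. by move=> Sx; have := euler_in S_step _ (step_itv n) Sx; apply. Qed.

(** Between two refinements, the error comes from halving the step
    ([euler_halve]) and from the finer polygon having possibly one more node
    before [t]. *)
Lemma polygon_increment x t : S x -> 0 <= t -> forall n,
  `|polygon n.+1 x t - polygon n x t| <=
  (M * h0 * (expR (L * t) + 1)) * 2^-1 ^+ n.
Proof.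
move=> Sx t0 n; rewrite /polygon -/(step n.+1) -/(step n).
have stepS : step n.+1 = step n / 2 by rewrite /step exprSr mulrA.
have /andP[kt tk] := truncn_step n t0.
set k := Num.truncn (t / step n) in kt tk *.
have /andP[jt tj] := truncn_step n.+1 t0.
set j := Num.truncn (t / step n.+1) in jt tj *.
have sn := step_gt0 n.
(* Halving the step doubles the number of steps up to [t], up to one. *)
have jk : j = k.*2 \/ j = k.*2.+1.
  rewrite stepS in jt tj.
  have jlo : (k.*2 < j.+1)%N.
    rewrite -(ltr_nat R) -(ltr_pM2r sn) -muln2 natrM -natr1.
    by move: kt tj; lra.
  have jhi : (j < k.*2.+2)%N.
    rewrite -(ltr_nat R) -(ltr_pM2r sn) -doubleS -muln2 natrM -natr1.
    by move: tk jt; lra.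
  rewrite ltnS in jlo; rewrite ltnS leq_eqVlt ltnS in jhi.
  case/orP: jhi => [/eqP ->|jhi]; [by right|left].
  by apply/eqP; rewrite eqn_leq jhi.
have le1 : `|euler f (step n.+1) j x - euler f (step n.+1) k.*2 x| <=
    M * step n.
  case: jk => ->; first by rewrite subrr normr0 mulr_ge0// ltW.
  have Se : S (euler f (step n.+1) k.*2 x).
    exact: (euler_in S_step _ (step_itv n.+1) Sx).
  have := euler_dist S_step f_bnd 1 (step_itv n.+1) Se.
  rewrite /= mul1r => /le_trans; apply.
  by rewrite ler_wpM2l// stepS ler_pdivrMr// ler_pMr// ler1n.
have le2 : `|euler f (step n.+1) k.*2 x - euler f (step n) k x| <=
    M * step n * expR (L * t).
  have := euler_halve S_step f_lip f_bnd L0 M0 k (step_itv n) Sx.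
  rewrite stepS => /le_trans; apply.
  by rewrite ler_wpM2l ?ler_expR ?ler_wpM2l// mulr_ge0// ltW.
rewrite (le_trans (ler_distD (euler f (step n.+1) k.*2 x) _ _))//.
rewrite (le_trans (lerD le1 le2))// le_eqVlt /step.
by apply/orP; left; apply/eqP; ring.
Qed.

Let polygon_split x s t n : 0 <= t <= s -> exists2 m,
  polygon n x s = euler f (step n) m (polygon n x t) &
  `|m%:R * step n - (s - t)| <= step n.
Proof.
move=> /andP[t0 ts]; have s0 := le_trans t0 ts; have sn := step_gt0 n.
rewrite /polygon -/(step n).
have /andP[kt tk] := truncn_step n t0.
set k := Num.truncn (t / step n) in kt tk *.
have /andP[js sj] := truncn_step n s0.
set j := Num.truncn (s / step n) in js sj *.
have kj : (k <= j)%N.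
  rewrite -ltnS -(ltr_nat R) -(ltr_pM2r sn) -natr1.
  by rewrite (le_lt_trans kt)// (le_lt_trans ts).
exists (j - k)%N; first by rewrite /euler -iterD subnK.
rewrite natrB// ler_norml; move: kt tk js sj; rewrite !mulrDl mul1r mulNr.
by move=> *; apply/andP; split; lra.
Qed.

(** The error term [M * step n] accounts for [s] and [t] not being nodes. *)
Lemma polygon_tangent x s t n : S x -> 0 <= t <= s ->
  `|polygon n x s - polygon n x t - (s - t) *: f (polygon n x t)| <=
  L * M * (s - t + step n) ^+ 2 + M * step n.
Proof.
move=> Sx tts; have [m -> mst] := polygon_split x n tts.
have Sz := polygon_in n t Sx; set z := polygon n x t in Sz *.
have eT := euler_tangent S_step f_lip f_bnd L0 M0 m (step_itv n) Sz.
set mh := m%:R * step n in mst eT *.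
have -> : euler f (step n) m z - z - (s - t) *: f z =
    (euler f (step n) m z - z - mh *: f z) + (mh - (s - t)) *: f z.
  by rewrite [in RHS]scalerBl addrA subrK.
rewrite (le_trans (ler_normD _ _))// normrZ lerD//; last first.
  by rewrite mulrC ler_pM ?f_bnd.
have mh0 : 0 <= mh by rewrite mulr_ge0// ltW.
rewrite (le_trans eT)// ler_wpM2l ?mulr_ge0// lerXn2r ?nnegrE//.
  by rewrite (le_trans mh0)// -lerBlDl (le_trans (ler_norm _)).
by rewrite -lerBlDl (le_trans (ler_norm _)).
Qed.

Lemma polygon_lipschitz x s t n : S x -> 0 <= t <= s ->
  `|polygon n x s - polygon n x t| <= M * (s - t + step n).
Proof.
move=> Sx tts; have [m -> mst] := polygon_split x n tts.
have Sz := polygon_in n t Sx.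
rewrite (le_trans (euler_dist S_step f_bnd m (step_itv n) Sz))// ler_wpM2l//.
by have := le_trans (ler_norm _) mst; rewrite lerBlDl.
Qed.

(** A Lyapunov function for the discrete scheme. The factor [expR (a * h0)] that
    the bound contains makes up for the node being up to one step before [t]. *)
Lemma polygon_decay (lam : X -> R) (a : R) : 0 <= a ->
  (forall x, 0 <= lam x) ->
  (forall x h, S x -> 0 < h <= h0 ->
     lam (x + h *: f x) <= (1 - a * h) * lam x) ->
  forall x t n, S x -> 0 <= t ->
    lam (polygon n x t) <= expR (- a * (t - h0)) * lam x.
Proof.
move=> a0 lam0 lam_step x t n Sx t0; have sn := step_itv n.
have decay k :
    lam (euler f (step n) k x) <= expR (- a * (k%:R * step n)) * lam x.
  elim: k => [|k IH] /=; first by rewrite mul0r mulr0 expR0 mul1r.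
  rewrite -/(euler f (step n) k x).
  rewrite (le_trans (lam_step _ _ (euler_in S_step k sn Sx) sn))//.
  rewrite (le_trans (ler_wpM2r (lam0 _) (expR_ge1Dx (- (a * step n)))))//.
  rewrite (le_trans (ler_wpM2l (expR_ge0 _) IH))// mulrA -expRD.
  rewrite le_eqVlt; apply/orP; left; apply/eqP; congr (expR _ * _).
  by rewrite -natr1; ring.
rewrite /polygon -/(step n) (le_trans (decay _))// ler_wpM2r// ler_expR.
have /andP[_ tk] := truncn_step n t0; have /andP[_ sh] := sn.
rewrite !mulNr lerN2 ler_wpM2l//.
by move: tk; rewrite mulrDl mul1r; lra.
Qed.

(** Picard-Lindelof by convergence of Euler polygons. The bound on chords is
    inherited from the polygons; it is the differential equation in a
    quantitative form, from which derivatives of both components of a pair can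
    be read off without integrating. *)
Theorem polygon_limit x0 : S x0 ->
  exists x : R -> X, [/\ x 0 = x0,
    forall t, 0 <= t -> S (x t),
    forall t, 0 <= t -> polygon n x0 t @[n --> \oo] --> x t &
    forall s t, 0 <= s -> 0 <= t ->
      `|x s - x t - (s - t) *: f (x t)| <= 2 * L * M * (s - t) ^+ 2].
Proof.
move=> Sx0; pose x t := lim (polygon n x0 t @[n --> \oo]).
have xP t : 0 <= t -> polygon n x0 t @[n --> \oo] --> x t.
  by move=> t0; apply: (geometric_increments_cvg (polygon_increment Sx0 t0)).
have Sx t : 0 <= t -> S (x t).
  move=> t0; apply: (@closed_cvg _ _ _ _ _ _ S_closed _ _ (xP t t0)).
  by apply: nearW => n; exact: polygon_in.
have fx t : 0 <= t -> f (polygon n x0 t) @[n --> \oo] --> f (x t).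
  move=> t0; apply/cvgrPdist_le => e e0.
  have e'0 : 0 < e / (L + 1) by rewrite divr_gt0// ltr_wpDl.
  have /cvgrPdist_le /(_ _ e'0) := xP t t0.
  apply: filterS => n; rewrite ler_pdivlMr ?ltr_wpDl// => xn.
  rewrite (le_trans (f_lip (Sx t t0) (polygon_in n t Sx0)))//.
  by rewrite (le_trans _ xn)// mulrC ler_wpM2l// lerDl.
(* The estimates on polygons pass to the limit for [t <= s]; for [s < t], the two
   endpoints are exchanged at the cost of the variation of [f] between them. *)
have tanx s t : 0 <= t <= s ->
    `|x s - x t - (s - t) *: f (x t)| <= L * M * (s - t) ^+ 2.
  move=> /andP[t0 ts]; have s0 := le_trans t0 ts.
  have c1 : `|polygon n x0 s - polygon n x0 t - (s - t) *: f (polygon n x0 t)|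
      @[n --> \oo] --> `|x s - x t - (s - t) *: f (x t)|.
    apply: cvg_norm; apply: cvgB; first by apply: cvgB; exact: xP.
    by apply: cvgZr; exact: fx.
  have c2 : L * M * (s - t + step n) ^+ 2 + M * step n @[n --> \oo] -->
      L * M * (s - t + 0) ^+ 2 + M * 0.
    apply: cvgD; last exact: cvgMr.
    apply: cvgMr; rewrite expr2.
    by apply: cvgM; apply: cvgD => //; exact: cvg_cst.
  have := ler_cvg_to c1 c2; rewrite addr0 mulr0 addr0; apply.
  by apply: nearW => n; apply: polygon_tangent; rewrite ?t0.
have lipx s t : 0 <= t <= s -> `|x s - x t| <= M * (s - t).
  move=> /andP[t0 ts]; have s0 := le_trans t0 ts.
  have c1 : `|polygon n x0 s - polygon n x0 t| @[n --> \oo] --> `|x s - x t|.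
    by apply: cvg_norm; apply: cvgB; exact: xP.
  have c2 : M * (s - t + step n) @[n --> \oo] --> M * (s - t + 0).
    by apply: cvgMr; apply: cvgD => //; exact: cvg_cst.
  have := ler_cvg_to c1 c2; rewrite addr0; apply.
  by apply: nearW => n; apply: polygon_lipschitz; rewrite ?t0.
exists x; split => //.
- apply: (cvg_unique (@norm_hausdorff _ X) (xP 0 (lexx 0))).
  rewrite (_ : (fun n => polygon n x0 0) = cst x0); first exact: cvg_cst.
  by apply/funext => n; rewrite /polygon mul0r truncn0.
- move=> s t s0 t0; have LM2 : 0 <= L * M * (s - t) ^+ 2.
    by rewrite mulr_ge0 ?sqr_ge0// mulr_ge0.
  have [ts|/ltW st] := leP t s.
    rewrite (le_trans (tanx s t _)) ?t0// -!mulrA ler_peMl ?ler1n//.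
    by rewrite mulrA.
  have -> : x s - x t - (s - t) *: f (x t) =
      - (x t - x s - (t - s) *: f (x s)) - (t - s) *: (f (x s) - f (x t)).
    rewrite -(opprB t s) scaleNr opprK -(opprB (x s) (x t)) scalerBr.
    by rewrite [- (- _ - _)]opprD !opprK opprB addrACA subrr addr0.
  rewrite (le_trans (ler_normB _ _))// normrN.
  have ts0 : 0 <= t - s by rewrite subr_ge0.
  have -> : 2 * L * M * (s - t) ^+ 2 =
    L * M * (t - s) ^+ 2 + (t - s) * (L * (M * (t - s))) by ring.
  rewrite lerD ?tanx ?s0// normrZ ger0_norm// ler_wpM2l//.
  rewrite (le_trans (f_lip (Sx s s0) (Sx t t0)))// ler_wpM2l//.
  by rewrite distrC lipx// s0.
Qed.

End Limit.
End EulerPolygons.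

(** * Adjoints in a real Hilbert space *)

Section HilbertSpace.
Context {R : realType} {H : completeNormedModType R} (dot : {dot H for idfun}).
Hypothesis dot_norm : forall x : H, dot x x = `|x| ^+ 2.

Lemma dotC x z : dot x z = dot z x.
Proof. by rewrite hermC expr0 mul1r. Qed.

Lemma dotDl x1 x2 z : dot (x1 + x2) z = dot x1 z + dot x2 z.
Proof. exact: linearDl. Qed.

Lemma dotZl a x z : dot (a *: x) z = a * dot x z.
Proof. exact: linearZl_LR. Qed.

Lemma dotDr x z1 z2 : dot x (z1 + z2) = dot x z1 + dot x z2.
Proof. by rewrite dotC dotDl !(dotC x). Qed.

Lemma dotZr a x z : dot x (a *: z) = a * dot x z.
Proof. by rewrite dotC dotZl (dotC x). Qed.

Lemma dotBl x1 x2 z : dot (x1 - x2) z = dot x1 z - dot x2 z.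
Proof. by rewrite -scaleN1r dotDl dotZl mulN1r. Qed.

Lemma dotBr x z1 z2 : dot x (z1 - z2) = dot x z1 - dot x z2.
Proof. by rewrite dotC dotBl !(dotC x). Qed.

Lemma sqr_normD x z : `|x + z| ^+ 2 = `|x| ^+ 2 + 2 * dot x z + `|z| ^+ 2.
Proof. by rewrite -!dot_norm dotDl !dotDr (dotC z x); ring. Qed.

Lemma sqr_normB x z : `|x - z| ^+ 2 = `|x| ^+ 2 - 2 * dot x z + `|z| ^+ 2.
Proof. by rewrite -!dot_norm dotBl !dotBr (dotC z x); ring. Qed.

Lemma dot_le x z : dot x z <= `|x| * `|z|.
Proof.
have : `|x + z| ^+ 2 <= (`|x| + `|z|) ^+ 2.
  by rewrite lerXn2r ?nnegrE ?addr_ge0// ler_normD.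
by rewrite sqr_normD; lra.
Qed.

Lemma normr_dot_le x z : `|dot x z| <= `|x| * `|z|.
Proof.
rewrite ler_norml dot_le andbT lerNl.
by have := dot_le (- x) z; rewrite -scaleN1r dotZl mulN1r scaleN1r normrN.
Qed.

Lemma dot_extensional x1 x2 : (forall z, dot z x1 = dot z x2) -> x1 = x2.
Proof.
move=> xx; apply/eqP; rewrite -subr_eq0 -normr_eq0 -sqrf_eq0 -dot_norm.
by rewrite dotBr xx subrr.
Qed.

(** The vector representing [phi] minimises [|x|^2 - 2 phi x]. By the
    parallelogram identity a minimising sequence whose defect is at most [4^-n]
    has increments at most [2 * 2^-n]; at the limit the first variation
    vanishes. *)
Theorem riesz_representation (phi : H -> R) (M : R) :
  (forall a x z, phi (a *: x + z) = a * phi x + phi z) ->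
  (forall x, `|phi x| <= M * `|x|) ->
  exists z, forall x, phi x = dot x z.
Proof.
move=> phi_lin phi_bnd.
have phiD x z : phi (x + z) = phi x + phi z.
  by rewrite -[x]scale1r phi_lin mul1r scale1r.
have phi0 : phi 0 = 0.
  by apply/eqP; rewrite -normr_le0 (le_trans (phi_bnd 0))// normr0 mulr0.
have phiZ a x : phi (a *: x) = a * phi x.
  by rewrite -[a *: x]addr0 phi_lin phi0 addr0.
pose J x := `|x| ^+ 2 - 2 * phi x.
have J_lb x : - M ^+ 2 <= J x.
  have := sqr_ge0 (`|x| - M); have := le_trans (ler_norm _) (phi_bnd x).
  by rewrite /J; nra.
have infJ : has_inf (range J).
  by split; [exists (J 0), 0|exists (- M ^+ 2) => _ [x _ <-]].
set I := inf (range J).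
have leIJ x : I <= J x by apply: ge_inf; [case: infJ|exists x].
pose eps n : R := (2^-1 ^+ n) ^+ 2.
have eps_gt0 n : 0 < eps n by rewrite !exprn_gt0// invr_gt0.
have /choice[x xJ] : forall n, exists x, J x < I + eps n.
  move=> n; have [_ [x _ <-] xI] := inf_adherent (eps_gt0 n) infJ.
  by exists x.
have x_cvg : cvg (x n @[n --> \oo]).
  apply: (@geometric_increments_cvg _ _ _ 2) => n.
  (* Comparison with the midpoint is the parallelogram identity in disguise. *)
  have mid := leIJ (2^-1 *: (x n.+1 + x n)).
  have J1 := xJ n.+1; have J0 := xJ n.
  have e1 : eps n.+1 <= eps n.
    rewrite /eps lerXn2r ?nnegrE ?exprn_ge0 ?invr_ge0// exprS.
    by rewrite ler_piMl ?exprn_ge0 ?invr_ge0// invf_le1// ler1n.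
  have e0 : eps n = (2^-1 ^+ n) ^+ 2 by [].
  rewrite -(@ler_pXn2r _ 2) ?nnegrE ?mulr_ge0 ?exprn_ge0 ?invr_ge0//.
  rewrite exprMn -e0; move: mid J1 J0 e1.
  rewrite /J normrZ exprMn ger0_norm ?invr_ge0// phiZ phiD sqr_normB sqr_normD.
  by lra.
pose z := lim (x n @[n --> \oo]); exists z => v.
have dotc : dot (x n) v @[n --> \oo] --> dot z v.
  apply/cvgrPdist_le => e e0.
  have e'0 : 0 < e / (`|v| + 1) by rewrite divr_gt0// ltr_wpDl.
  have /cvgrPdist_le /(_ _ e'0) := x_cvg.
  apply: filterS => n; rewrite ler_pdivlMr ?ltr_wpDl// => xn.
  rewrite -dotBl (le_trans (normr_dot_le _ _))//.
  by rewrite (le_trans _ xn)// ler_wpM2l// lerDl.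
have eps0 : eps n @[n --> \oo] --> 0.
  have h0 : (2^-1 : R) ^+ n @[n --> \oo] --> 0.
    by apply: cvg_expr; rewrite normfV ger0_norm// invf_lt1// ltr1n.
  by have := cvgM h0 h0; rewrite mulr0; exact.
have var t : 0 <= t ^+ 2 * `|v| ^+ 2 + 2 * t * (dot z v - phi v).
  have c : t ^+ 2 * `|v| ^+ 2 + 2 * t * (dot (x n) v - phi v) + eps n
      @[n --> \oo] --> t ^+ 2 * `|v| ^+ 2 + 2 * t * (dot z v - phi v) + 0.
    apply: cvgD => //; apply: cvgD; first exact: cvg_cst.
    by apply: cvgMr; apply: cvgB => //; exact: cvg_cst.
  rewrite addr0 in c; apply: (cvgr_to_ge c).
  apply: nearW => n; have := leIJ (x n + t *: v); have := xJ n.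
  rewrite /J sqr_normD phiD phiZ dotZr normrZ exprMn real_normK ?num_real//.
  by lra.
pose d := dot z v - phi v.
suff d0 : d = 0 by rewrite dotC; apply/eqP; rewrite eq_sym -subr_eq0; exact/eqP.
pose N := `|v| ^+ 2 + 1.
have N0 : 0 < N by rewrite ltr_wpDl ?sqr_ge0.
(* [- d / `|v| ^+ 2] minimises the quadratic; the 1 in [N] excludes a division
   by zero. *)
have := var (- d / N); rewrite -/d.
have -> : (- d / N) ^+ 2 * `|v| ^+ 2 + 2 * (- d / N) * d =
    - (d ^+ 2 * (`|v| ^+ 2 + 2)) / N ^+ 2 by rewrite /N; field; rewrite gt_eqF.
rewrite mulNr oppr_ge0 pmulr_lle0 ?invr_gt0 ?exprn_gt0//.
rewrite pmulr_lle0 ?ltr_wpDl ?sqr_ge0//.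
by move=> d2; apply/eqP; rewrite -sqrf_eq0 eq_le d2 sqr_ge0.
Qed.

Definition adjoint_pair (A B : H -> H) := forall x z, dot (A x) z = dot x (B z).

(** Test the defining identity at [x = B z]. *)
Lemma adjoint_pair_bound (A : 'B(H)) (B : H -> H) : adjoint_pair A B ->
  forall z, `|B z| <= `|A| * `|z|.
Proof.
move=> AB z; have [->|Bz] := eqVneq (B z) 0; first by rewrite normr0 mulr_ge0.
have Bz0 : 0 < `|B z| by rewrite normr_gt0.
rewrite -(ler_pM2l Bz0) -expr2 -dot_norm -AB (le_trans (dot_le _ _))//.
by rewrite mulrA ler_wpM2r// mulrC bop_norm_le.
Qed.

Lemma adjoint_pair_norm (A B : 'B(H)) : adjoint_pair A B -> `|B| <= `|A|.
Proof. by move=> /adjoint_pair_bound; exact: bop_le_norm. Qed.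

Lemma adjoint_exists (A : 'B(H)) : exists B : 'B(H), adjoint_pair A B.
Proof.
have /choice[B BP] : forall z, exists w, forall x, dot (A x) z = dot x w.
  move=> z; apply: (@riesz_representation (fun x => dot (A x) z) (`|A| * `|z|)).
    by move=> a x1 x2; rewrite linearP dotDl dotZl.
  move=> x; rewrite (le_trans (normr_dot_le _ _))// mulrAC ler_wpM2r//.
  exact: bop_norm_le.
have B_lin : linear B.
  move=> a z1 z2; apply: dot_extensional => x.
  by rewrite -BP !dotDr !dotZr !BP.
have B_bl : B \in bounded_linear (V := H) (W := H).
  rewrite inE; split=> //; exists `|A|; apply: adjoint_pair_bound => x z.
  exact: BP.
by exists (Bop B_bl) => x z; exact: BP.
Qed.

Lemma adjointP (A : 'B(H)) : adjoint_pair A (adjoint dot A).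
Proof.
rewrite /adjoint; have [B AB] := adjoint_exists A.
exact: (@xgetPex _ 0 [set B : 'B(H) | adjoint_pair A B] (ex_intro _ B AB)).
Qed.

Lemma adjoint_norm A : `|adjoint dot A| <= `|A|.
Proof. exact/adjoint_pair_norm/adjointP. Qed.

(** The difference of the adjoints is adjoint to the difference. *)
Lemma adjoint_dist A B : `|adjoint dot A - adjoint dot B| <= `|A - B|.
Proof.
by apply: adjoint_pair_norm => x z; rewrite !bopBE dotBl dotBr !adjointP.
Qed.

End HilbertSpace.

(** * Differential equations in normed spaces *)

Section Ode.
Context {R : realType}.

Lemma tderiv_tangent (V : normedModType R) (f : R -> V) (t : R) (v : V) :
  is_tderiv f t v -> tangent_within [set s | 0 <= s] f t v.
Proof.
move=> /cvgrPdist_le fv eps eps0.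
have /nbhs_ballP[d /= d0 df] := fv eps eps0.
exists d => // s s0 st; have [->|st0] := eqVneq s t.
  by rewrite !subrr scale0r subr0 !normr0 mulr0.
have := df s; rewrite /ball /= distrC => /(_ st st0 s0).
have st1 : s - t != 0 by rewrite subr_eq0.
rewrite -(ler_pM2r (_ : 0 < `|s - t|)) ?normr_gt0//.
rewrite mulrC -normrZ scalerBr scalerA divff// scale1r.
by rewrite -normrN opprB.
Qed.

Lemma quadratic_tderiv (V : normedModType R) (f : R -> V) (t C : R) (v : V) :
  (forall s, 0 <= s -> `|f s - f t - (s - t) *: v| <= C * (s - t) ^+ 2) ->
  is_tderiv f t v.
Proof.
move=> fC; apply/cvgrPdist_le => eps eps0.
have N0 : 0 < `|C| + 1 by rewrite ltr_wpDl.
apply/nbhs_ballP; exists (eps / (`|C| + 1)); first by rewrite /= divr_gt0.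
move=> s; rewrite /ball /= distrC ltr_pdivlMr// => std st0 s0.
have st1 : s - t != 0 by rewrite subr_eq0.
have st : 0 < `|s - t| by rewrite normr_gt0.
rewrite -(ler_pM2r st) mulrC -normrZ scalerBr scalerA divff// scale1r.
rewrite -normrN opprB (le_trans (fC s s0))//.
rewrite -[(s - t) ^+ 2]real_normK ?num_real// expr2 mulrA ler_wpM2r//.
rewrite (le_trans _ (ltW std))// mulrC ler_wpM2l//.
by rewrite (le_trans (ler_norm _))// lerDl.
Qed.

Lemma tangent_withinS (V : normedModType R) (D E : set R) (f : R -> V) t v :
  E `<=` D -> tangent_within D f t v -> tangent_within E f t v.
Proof.
move=> ED fv eps eps0; have [d d0 fd] := fv eps eps0.
by exists d => // s /ED; exact: fd.
Qed.

Lemma tangent_withinB (V : normedModType R) (D : set R) (f g : R -> V) t v w :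
  tangent_within D f t v -> tangent_within D g t w ->
  tangent_within D (fun s => f s - g s) t (v - w).
Proof.
move=> fv gw eps eps0; have e2 : 0 < eps / 2 by rewrite divr_gt0.
have [d1 d10 fd] := fv _ e2; have [d2 d20 gd] := gw _ e2.
exists (Num.min d1 d2); first by rewrite lt_min d10.
move=> s Ds; rewrite lt_min => /andP[st1 st2].
have -> : f s - g s - (f t - g t) - (s - t) *: (v - w) =
    (f s - f t - (s - t) *: v) - (g s - g t - (s - t) *: w).
  by rewrite scalerBr (subACA (f s)) [LHS]subACA.
rewrite [in leRHS](splitr eps) mulrDl (le_trans (ler_normB _ _))//.
by apply: lerD; [exact: fd|exact: gd].
Qed.

Lemma tangent_within_pair (V W : normedModType R) (D : set R)
    (f : R -> V) (g : R -> W) t v w :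
  tangent_within D f t v -> tangent_within D g t w ->
  tangent_within D (fun s => (f s, g s) : V * W) t (v, w).
Proof.
move=> fv gw eps eps0.
have [d1 d10 fd] := fv _ eps0; have [d2 d20 gd] := gw _ eps0.
exists (Num.min d1 d2); first by rewrite lt_min d10.
move=> s Ds; rewrite lt_min => /andP[st1 st2].
by rewrite prod_normE ge_max fd//= gd.
Qed.

(** Gronwall's inequality for a second solution [z] about which nothing is known
    beforehand. The fence [e' * expR ((L + 1) * (t - T))] is at most [rad] on
    [[0, T]], so below the fence [z t] lies in [G] and the Lipschitz bound
    applies; [e'] is arbitrarily small. The rate [L + 1] exceeds [L] to leave
    room for the error in the definition of the derivative. *)
Lemma ode_unique (X : normedModType R) (f : X -> X) (G : set X) (L rad : R)
    (x z : R -> X) : 0 <= L -> 0 < rad ->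
  (forall a b, G a -> G b -> `|f a - f b| <= L * `|a - b|) ->
  (forall t w, 0 <= t -> `|w - x t| <= rad -> G w) ->
  (forall t, 0 <= t -> tangent_within [set s | 0 <= s] x t (f (x t))) ->
  (forall t, 0 <= t -> tangent_within [set s | 0 <= s] z t (f (z t))) ->
  z 0 = x 0 -> forall t, 0 <= t -> z t = x t.
Proof.
move=> L0 rad0 f_lip xG xE zE zx0 T T0.
apply/eqP; rewrite -subr_eq0 -normr_le0.
apply/ler_addgt0Pl => e e0; rewrite addr0.
pose e' := Num.min e rad.
have e'0 : 0 < e' by rewrite lt_min e0.
have e'e : e' <= e by rewrite ge_min lexx.
have e'r : e' <= rad by rewrite ge_min lexx orbT.
pose psi t := e' * expR ((L + 1) * (t - T)).
have psi_homo : {homo psi : s t / s <= t}.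
  move=> s t st; rewrite ler_wpM2l ?(ltW e'0)// ler_expR.
  by rewrite ler_wpM2l ?addr_ge0// lerD2r.
have psiT : psi T = e' by rewrite /psi subrr mulr0 expR0 mulr1.
have psi0 t : 0 < psi t by rewrite mulr_gt0// expR_gt0.
rewrite (le_trans _ e'e)// -psiT.
apply: (@norm_fence R X T (fun t => z t - x t)
  (fun t => f (z t) - f (x t)) psi);
  last by rewrite lexx T0.
- move=> t /andP[t0 _]; apply: (@tangent_withinS _ [set s | 0 <= s]).
    by move=> s /= /andP[].
  by apply: tangent_withinB; [exact: zE|exact: xE].
- by move=> s t _ _; exact: psi_homo.
- by rewrite zx0 subrr normr0 ltW.
- move=> t /andP[t0 tT] zxt; exists (psi t) => // s /andP[ts _].
  have zt : `|z t - x t| <= rad.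
    by rewrite (le_trans zxt)// (le_trans _ e'r)// -psiT psi_homo// ltW.
  have xt : `|x t - x t| <= rad by rewrite subrr normr0 ltW.
  have fzx := f_lip _ _ (xG t _ t0 zt) (xG t _ t0 xt).
  have fzx' : `|f (z t) - f (x t)| <= L * psi t.
    by rewrite (le_trans fzx)// ler_wpM2l.
  have st : 0 <= s - t by rewrite subr_ge0 ltW.
  apply: (@le_trans _ _ (psi t * (1 + (L + 1) * (s - t)))).
    rewrite [in leRHS]mulrDr mulr1 lerD2l.
    apply: (le_trans (ler_wpM2l st (lerD fzx' (lexx _)))).
    by rewrite le_eqVlt; apply/orP; left; apply/eqP; ring.
  apply: (le_trans (ler_wpM2l (ltW (psi0 t)) (expR_ge1Dx _))).
  rewrite /psi -mulrA -expRD -mulrDr.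
  by rewrite (_ : t - T + (s - t) = s - T)//; ring.
Qed.

End Ode.

(** * The Newton flow *)

(** A telescoping of the difference of two right-hand sides of the equation for
    [Q], changing one factor at a time. *)
Lemma operator_field_subE (R : realType) (H : normedModType R)
  (A As Q C Cs P : 'B(H)) :
  - bop_comp (bop_comp As A) Q + As - (- bop_comp (bop_comp Cs C) P + Cs) =
  (As - Cs) - (bop_comp As (bop_comp A (Q - P)) +
               bop_comp As (bop_comp (A - C) P) +
               bop_comp (As - Cs) (bop_comp C P)).
Proof.
apply: bop_ext => x.
transitivity ((As x - Cs x) - (As (A (Q x - P x)) + As (A (P x) - C (P x)) +
    (As (C (P x)) - Cs (C (P x))))); last by [].
transitivity (- As (A (Q x)) + As x - (- Cs (C (P x)) + Cs x)); first by [].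
rewrite (linearB A) !(linearB As) subrKA subrKA.
by rewrite (addrC (- As _)) (addrC (- Cs _)) subACA.
Qed.

Lemma operator_field_dist (R : realType) (H : normedModType R)
    (A As Q C Cs P : 'B(H)) (M K N D : R) : 0 <= D ->
  `|As| <= M -> `|A| <= M -> `|C| <= M -> `|P| <= N ->
  `|A - C| <= K * D -> `|As - Cs| <= K * D -> `|Q - P| <= D ->
  `|- bop_comp (bop_comp As A) Q + As - (- bop_comp (bop_comp Cs C) P + Cs)| <=
  (M * M + M * K * N + K * M * N + K) * D.
Proof.
move=> D0 AsM AM CM PN AC AsCs QP.
have comp2 (a b c : 'B(H)) : `|bop_comp a (bop_comp b c)| <= `|a| * `|b| * `|c|.
  by rewrite -mulrA (le_trans (bop_comp_norm _ _))// ler_wpM2l// bop_comp_norm.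
rewrite operator_field_subE (le_trans (ler_normB _ _))//.
have -> : (M * M + M * K * N + K * M * N + K) * D =
  K * D + (M * M * D + M * (K * D) * N + K * D * M * N) by ring.
apply: lerD => //; apply: (le_trans (ler_normD _ _)); apply: lerD.
  apply: (le_trans (ler_normD _ _)); apply: lerD.
    apply: (le_trans (comp2 _ _ _)).
    by rewrite !ler_pM ?mulr_ge0.
  by apply: (le_trans (comp2 _ _ _)); rewrite !ler_pM ?mulr_ge0.
by apply: (le_trans (comp2 _ _ _)); rewrite !ler_pM ?mulr_ge0.
Qed.

Section NewtonFlow.
Context {R : realType} {H : completeNormedModType R} (dot : {dot H for idfun}).
Hypothesis dot_norm : forall x : H, dot x x = `|x| ^+ 2.
Variables (F : H -> H) (y u0 : H) (r M1 M2 m1 : R).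
Hypothesis Fy0 : F y = 0.
Hypotheses (M1_gt0 : 0 < M1) (M2_gt0 : 0 < M2) (m1_gt0 : 0 < m1).
Let B := cball u0 r.
Let F' := fderiv F.
Hypothesis By : B y.
Hypothesis F_diff :
  forall u, B u -> differentiable F u /\ differentiable_within B F' u.
Hypothesis F_bnd :
  forall u, B u -> `|F' u| <= M1 /\ `|fderiv_within B F' u| <= M2.
Hypothesis F_inv :
  forall u, B u -> boundedly_invertible (F' u) /\ `|bop_inv (F' u)| <= m1.
Let Ai := bop_inv (F' y).

Lemma derivK u : B u -> cancel (F' u) (bop_inv (F' u)).
Proof. by move=> /F_inv[/bop_invP[]]. Qed.

Lemma deriv_invK u : B u -> cancel (bop_inv (F' u)) (F' u).
Proof. by move=> /F_inv[/bop_invP[]]. Qed.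

(** The form in which invertibility of the derivatives is used: [F' u] is
    bounded below by [1 / m1], hence its composite with its adjoint by
    [1 / m1 ^+ 2]. *)
Lemma deriv_below u x : B u -> `|x| <= m1 * `|F' u x|.
Proof.
move=> Bu; rewrite -[in leLHS](derivK Bu x) (le_trans (bop_norm_le _ _))//.
by rewrite ler_wpM2r//; have [] := F_inv Bu.
Qed.

Lemma F_lipschitz u v : B u -> B v -> `|F v - F u| <= M1 * `|v - u|.
Proof.
apply: (frechet_lipschitz (@cball_segment_closed _ _ _ _) (df := F')).
  move=> w Bw eps eps0; have [d d0 Fd] := fderiv_frechet (F_diff Bw).1 eps0.
  by exists d => // x _; exact: Fd.
by move=> w Bw; have [] := F_bnd Bw.
Qed.

Lemma F'_lipschitz u v : B u -> B v -> `|F' v - F' u| <= M2 * `|v - u|.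
Proof.
apply: (frechet_lipschitz (@cball_segment_closed _ _ _ _)
  (df := fderiv_within B F')).
  by move=> w Bw; apply: fderiv_within_frechet => //; exact: (F_diff Bw).2.
by move=> w Bw; have [] := F_bnd Bw.
Qed.

(** The mean value inequality for [x |-> F x - F'(y) x], whose derivative is at
    most [M2 * |u - y|] on the part of the ball that is no farther from [y] than
    [u]. The missing factor 1/2 of Taylor's formula is immaterial. *)
Lemma F_taylor u : B u -> `|F u - F' y (u - y)| <= M2 * `|u - y| ^+ 2.
Proof.
move=> Bu; pose D := B `&` cball y `|u - y|.
have Dseg : segment_closed D.
  move=> a b [Ba Ya] [Bb Yb] t t01.
  by split; apply: cball_segment_closed.
have := @frechet_lipschitz R H H D
  (fun x => F x - F' y x) (fun x => F' x - F' y) (M2 * `|u - y|) Dseg.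
have -> : F u - F' y (u - y) = F u - F' y u - (F y - F' y y).
  by rewrite linearB Fy0 /= sub0r opprK opprB addrA addrAC.
rewrite expr2 mulrA; apply.
- move=> w [Bw _] eps eps0; have [d d0 Fd] := fderiv_frechet (F_diff Bw).1 eps0.
  exists d => // x _ xw; have := Fd x I xw.
  by rewrite (subACA (F x)) -bop_linearB bopBE subACA subrr subr0.
- move=> w [Bw Yw]; rewrite (le_trans (F'_lipschitz By Bw))// ler_wpM2l// ltW//.
- by split => //; rewrite /cball /= subrr normr0.
- by split => //; rewrite /cball /=.
Qed.

Definition newton_field (z : H * 'B(H)) : H * 'B(H) :=
  let A := F' z.1 in
  (- z.2 (F z.1),
   - bop_comp (bop_comp (adjoint dot A) A) z.2 + adjoint dot A).

Section Lipschitz.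
Variable N : R.
Hypothesis N0 : 0 <= N.
Let G := [set z : H * 'B(H) | B z.1 /\ `|z.2| <= N].

Lemma F_norm u : B u -> `|F u| <= M1 * (2 * r).
Proof.
move=> Bu; have := F_lipschitz By Bu; rewrite Fy0 subr0 => /le_trans; apply.
rewrite ler_wpM2l ?(ltW M1_gt0)// (le_trans (ler_distD u0 _ _))//.
by rewrite mulr_natl mulr2n lerD// distrC.
Qed.

Lemma adjoint_deriv_norm u : B u -> `|adjoint dot (F' u)| <= M1.
Proof.
move=> Bu; rewrite (le_trans (adjoint_norm dot_norm _))//.
by have [] := F_bnd Bu.
Qed.

Lemma newton_field_bounded z : G z ->
  `|newton_field z| <= M1 * (2 * r) * N + (M1 * M1 * N + M1).
Proof.
case: z => u Q [/= Bu QN]; have [A1 _] := F_bnd Bu.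
have r0 : 0 <= r by rewrite (le_trans _ Bu).
have As := adjoint_deriv_norm Bu.
have M10 := ltW M1_gt0.
have a0 : 0 <= M1 * (2 * r) * N by rewrite !mulr_ge0.
have b0 : 0 <= M1 * M1 * N + M1 by rewrite addr_ge0// !mulr_ge0.
rewrite prod_normE ge_max /=; apply/andP; split.
  rewrite normrN ler_wpDr// (le_trans (bop_norm_le _ _))// mulrC.
  by rewrite ler_pM// F_norm.
rewrite ler_wpDl// (le_trans (ler_normD _ _))// normrN lerD//.
rewrite (le_trans (bop_comp_norm _ _))// ler_pM//.
by rewrite (le_trans (bop_comp_norm _ _))// ler_pM.
Qed.

Let L := (M1 * (2 * r) + N * M1) + (M1 * M1 + M1 * M2 * N + M2 * M1 * N + M2).

(** The bound [N] on [Q] enters because the field contains products of [Q] with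
    functions of [u]. *)
Lemma newton_field_lipschitz z w : G z -> G w ->
  `|newton_field z - newton_field w| <= L * `|z - w|.
Proof.
case: z w => [u Q] [v P] [/= Bu QN] [/= Bv PN].
set D := `|_ - (v, P)|.
have uvD : `|u - v| <= D by rewrite /D prod_normE le_max lexx.
have QPD : `|Q - P| <= D by rewrite /D prod_normE le_max lexx orbT.
have D0 : 0 <= D by rewrite normr_ge0.
have r0 : 0 <= r by rewrite (le_trans _ Bu).
have M10 := ltW M1_gt0; have M20 := ltW M2_gt0.
have [A1 _] := F_bnd Bu; have [A2 _] := F_bnd Bv.
have As1 := adjoint_deriv_norm Bu; have As2 := adjoint_deriv_norm Bv.
have AA : `|F' u - F' v| <= M2 * D.
  by rewrite (le_trans (F'_lipschitz Bv Bu))// ler_wpM2l.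
have AAs : `|adjoint dot (F' u) - adjoint dot (F' v)| <= M2 * D.
  by rewrite (le_trans (adjoint_dist dot_norm _ _)).
have FF : `|F u - F v| <= M1 * D.
  by rewrite (le_trans (F_lipschitz Bv Bu))// ler_wpM2l.
have a0 : 0 <= (M1 * (2 * r) + N * M1) * D.
  by rewrite mulr_ge0// addr_ge0// !mulr_ge0.
have b0 : 0 <= (M1 * M1 + M1 * M2 * N + M2 * M1 * N + M2) * D.
  by rewrite mulr_ge0// !addr_ge0// !mulr_ge0.
rewrite /L mulrDl prod_normE ge_max /=; apply/andP; split.
  rewrite ler_wpDr// opprK addrC -normrN opprB.
  have -> : Q (F u) - P (F v) = (Q - P) (F u) + P (F u - F v).
    by rewrite bopBE linearB /= addrA subrK.
  rewrite (le_trans (ler_normD _ _))// mulrDl lerD//.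
    by rewrite (le_trans (bop_norm_le _ _))// mulrC ler_pM// F_norm.
  by rewrite (le_trans (bop_norm_le _ _))// -mulrA ler_pM.
rewrite ler_wpDl//.
exact: operator_field_dist.
Qed.

End Lipschitz.

(** One step is [(1 - h) w + h e] with [e = - J (F u - F'(y) w) - (Q - J) (F u)]
    and [J = F'(y)^-1]; the two smallness hypotheses make each of the two terms
    of [e] at most [|w| / 4]. *)
Lemma newton_step_contracts (u : H) (Q : 'B(H)) (rho delta h : R) :
  B u -> `|u - y| <= rho -> `|Q - Ai| <= delta ->
  m1 * M2 * rho <= 4^-1 -> M1 * delta <= 4^-1 -> 0 < h <= 1 ->
  `|u + h *: (- Q (F u)) - y| <= (1 - 2^-1 * h) * `|u - y|.
Proof.
move=> Bu urho Qdelta m1M2rho M1delta /andP[h0 h1].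
set w := u - y in urho *.
have [_ Aim] := F_inv By.
have Aiw : Ai (F' y w) = w by exact: derivK.
have -> : u + h *: (- Q (F u)) - y =
    (1 - h) *: w + h *: (- Ai (F u - F' y w) - (Q - Ai) (F u)).
  rewrite (bop_linearB Ai) Aiw bopBE !opprB subrKA.
  by rewrite [h *: (w - _)]scalerDr addrA -scalerDl subrK scale1r addrAC.
have w0 : 0 <= `|w| by [].
have e1 : `|Ai (F u - F' y w)| <= 4^-1 * `|w|.
  rewrite (le_trans (bop_norm_le _ _))//.
  apply: (@le_trans _ _ (m1 * (M2 * `|w| ^+ 2))).
    by rewrite ler_pM// F_taylor.
  rewrite expr2 !mulrA ler_wpM2r// (le_trans _ m1M2rho)// ler_wpM2l//.
  by rewrite mulr_ge0// ltW.
have e2 : `|(Q - Ai) (F u)| <= 4^-1 * `|w|.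
  rewrite (le_trans (bop_norm_le _ _))//.
  apply: (@le_trans _ _ (delta * (M1 * `|w|))).
    by rewrite ler_pM//; have := F_lipschitz By Bu; rewrite Fy0 subr0.
  by rewrite mulrA ler_wpM2r// mulrC.
rewrite (le_trans (ler_normD _ _))// !normrZ (gtr0_norm h0).
rewrite ger0_norm ?subr_ge0//.
have e3 : `|- Ai (F u - F' y w) - (Q - Ai) (F u)| <= 2^-1 * `|w|.
  by rewrite (le_trans (ler_normB _ _))// normrN; lra.
by have := ler_wpM2l (ltW h0) e3; lra.
Qed.

(** With [a = F'(u) x], expanding the square gives
    [|x|^2 - 2 h |a|^2 + h^2 |At a|^2], where [At] is the adjoint of [F'(u)].
    The last term is at most [h |a|^2] for a short step, so at least [h |a|^2]
    is gained, and [|a| >= |x| / m1]. *)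
Lemma gradient_step_contracts (u x : H) (h : R) : B u ->
  0 < h -> h * M1 ^+ 2 <= 1 -> h <= m1 ^+ 2 ->
  `|x - h *: adjoint dot (F' u) (F' u x)| <= (1 - h / (2 * m1 ^+ 2)) * `|x|.
Proof.
move=> Bu h0 hM1 hm1.
have m12 : 0 < m1 ^+ 2 by rewrite exprn_gt0.
have M10 := ltW M1_gt0.
set As := adjoint dot (F' u); set a := F' u x.
have q0 : 0 <= 1 - h / (2 * m1 ^+ 2).
  rewrite subr_ge0 ler_pdivrMr ?mulr_gt0// mul1r (le_trans hm1)//.
  by rewrite ler_peMl ?ler1n// ltW.
rewrite -(@ler_pXn2r _ 2) ?nnegrE ?mulr_ge0//.
rewrite (sqr_normB dot_norm) (dotZr dot) -(adjointP dot_norm) -/a dot_norm.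
rewrite normrZ gtr0_norm//.
have As1 : `|As a| ^+ 2 <= M1 ^+ 2 * `|a| ^+ 2.
  rewrite -exprMn lerXn2r ?nnegrE ?mulr_ge0// (le_trans (bop_norm_le _ _))//.
  by rewrite ler_wpM2r// adjoint_deriv_norm.
have ax : `|x| ^+ 2 <= m1 ^+ 2 * `|a| ^+ 2.
  by rewrite -exprMn lerXn2r ?nnegrE ?mulr_ge0 ?(ltW m1_gt0)// deriv_below.
have ax' : `|x| ^+ 2 / m1 ^+ 2 <= `|a| ^+ 2 by rewrite ler_pdivrMr// mulrC.
rewrite !exprMn.
have step1 : h ^+ 2 * `|As a| ^+ 2 <= h * `|a| ^+ 2.
  apply: (@le_trans _ _ (h ^+ 2 * (M1 ^+ 2 * `|a| ^+ 2))).
    by rewrite ler_wpM2l// sqr_ge0.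
  rewrite [h ^+ 2]expr2 -mulrA ler_wpM2l ?(ltW h0)// mulrA.
  by rewrite ler_piMl// sqr_ge0.
have step2 : h * (`|x| ^+ 2 / m1 ^+ 2) <= h * `|a| ^+ 2.
  by rewrite ler_wpM2l// ltW.
have step3 : (1 - h / m1 ^+ 2) * `|x| ^+ 2 <=
    (1 - h / (2 * m1 ^+ 2)) ^+ 2 * `|x| ^+ 2.
  rewrite ler_wpM2r ?sqr_ge0// -subr_ge0.
  have -> : (1 - h / (2 * m1 ^+ 2)) ^+ 2 - (1 - h / m1 ^+ 2) =
     (h / (2 * m1 ^+ 2)) ^+ 2 by field; rewrite gt_eqF.
  by rewrite sqr_ge0.
apply: le_trans step3.
have -> : (1 - h / m1 ^+ 2) * `|x| ^+ 2 =
    `|x| ^+ 2 - h * (`|x| ^+ 2 / m1 ^+ 2) by ring.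
by lra.
Qed.

(** With [A = F'(u)], [At] its adjoint and [J = F'(y)^-1], one step maps
    [V = Q - J] to [(1 - h At A) V + h At (F'(y) - A) J]: the first term is
    contracted by [gradient_step_contracts], the second is small because [F'] is
    Lipschitz. *)
Lemma inverse_step_estimate (u : H) (Q : 'B(H)) (h : R) : B u ->
  0 < h -> h * M1 ^+ 2 <= 1 -> h <= m1 ^+ 2 ->
  `|Q + h *: (- bop_comp (bop_comp (adjoint dot (F' u)) (F' u)) Q +
              adjoint dot (F' u)) - Ai| <=
  (1 - h / (2 * m1 ^+ 2)) * `|Q - Ai| + h * (M1 * M2 * m1) * `|u - y|.
Proof.
move=> Bu h0 hM1 hm1; have [_ Aim] := F_inv By.
have As_le := adjoint_deriv_norm Bu.
have AsP := gradient_step_contracts _ Bu h0 hM1 hm1.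
move: (adjoint dot (F' u)) As_le AsP => As As_le AsP.
have q0 : 0 <= 1 - h / (2 * m1 ^+ 2).
  have m12 : 0 < m1 ^+ 2 by rewrite exprn_gt0.
  rewrite subr_ge0 ler_pdivrMr ?mulr_gt0// mul1r (le_trans hm1)//.
  by rewrite ler_peMl ?ler1n// ltW.
apply: bop_le_norm => [|x].
  by rewrite addr_ge0// mulr_ge0// !mulr_ge0// ltW.
set V := Q - Ai; set A := F' u.
have -> : (Q + h *: (- bop_comp (bop_comp As A) Q + As) - Ai) x =
   (V x - h *: As (A (V x))) + h *: As ((F' y - A) (Ai x)).
  transitivity (Q x + h *: (- As (A (Q x)) + As x) - Ai x); first by [].
  transitivity ((Q x - Ai x) - h *: As (A (Q x - Ai x)) +
      h *: As (F' y (Ai x) - A (Ai x))); last by [].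
  rewrite deriv_invK// (bop_linearB A) !(bop_linearB As).
  rewrite -[RHS]addrA -scalerN -scalerDr opprB.
  by rewrite [X in X + (As x - _)]addrC addrACA subrr addr0 addrAC.
rewrite (le_trans (ler_normD _ _))// mulrDl lerD//.
  rewrite -mulrA (le_trans (AsP _))//.
  by rewrite ler_wpM2l// bop_norm_le.
rewrite normrZ gtr0_norm// -!mulrA ler_wpM2l ?(ltW h0)//.
rewrite (le_trans (bop_norm_le _ _))// ler_pM//.
rewrite (le_trans (bop_norm_le _ _))//.
have -> : M2 * (m1 * (`|u - y| * `|x|)) = (M2 * `|y - u|) * (m1 * `|x|).
  by rewrite distrC; ring.
rewrite ler_pM//; first exact: F'_lipschitz.
by rewrite (le_trans (bop_norm_le _ _))// ler_wpM2r.
Qed.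

Variables (Q0 : 'B(H)) (rho delta : R).
Hypotheses (r_gt0 : 0 < r) (rho_gt0 : 0 < rho) (delta_ge0 : 0 <= delta).
Hypothesis rho_r : rho + `|u0 - y| <= r / 2.
Hypothesis rho_small : m1 * M2 * rho <= 4^-1.
Hypothesis delta_small : M1 * delta <= 4^-1.
Hypothesis rho_delta : M1 * M2 * m1 * rho <= delta / (2 * m1 ^+ 2).
Hypotheses (u0y : `|u0 - y| <= rho) (Q0Ai : `|Q0 - Ai| <= delta).
Let f := newton_field.
Let S := [set z : H * 'B(H) | `|z.1 - y| <= rho /\ `|z.2 - Ai| <= delta].
Let N := m1 + delta + 1.
Let G := [set z : H * 'B(H) | B z.1 /\ `|z.2| <= N].
Let h0 := Num.min 1 (Num.min (M1 ^- 2) (m1 ^+ 2)).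

Let S_near z : S z -> `|z.1 - u0| <= r / 2 /\ `|z.2| <= m1 + delta.
Proof.
move=> [zy zA]; split.
  by rewrite (le_trans (ler_distD y _ _))// (le_trans _ rho_r)// lerD// distrC.
have [_ Aim] := F_inv By.
rewrite -[z.2](subrK Ai) addrC (le_trans (ler_normD _ _))// lerD//.
Qed.

(** The field is Lipschitz on a whole neighbourhood of [S], with a margin that
    does not depend on the point: this is where other solutions are controlled. *)
Let G_near z w : S z -> `|w - z| <= Num.min (r / 2) 1 -> G w.
Proof.
move=> /S_near[zu zQ]; rewrite prod_normE ge_max !le_min.
move=> /andP[/andP[w1 _] /andP[_ w2]]; split.
  rewrite /B /cball /= (le_trans (ler_distD z.1 _ _))//.
  by rewrite (le_trans (lerD w1 zu))// -splitr.
rewrite -[w.2](subrK z.2) addrC (le_trans (ler_normD _ _))//.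
by rewrite lerD.
Qed.

Let S_G z : S z -> G z.
Proof.
by move=> Sz; apply: (G_near Sz); rewrite subrr normr0 le_min divr_ge0//= ltW.
Qed.

Let S_closed : closed S.
Proof.
have -> : S =
  (fun z : H * 'B(H) => `|z.1 - y|) @^-1` [set a | a <= rho] `&`
  (fun z : H * 'B(H) => `|z.2 - Ai|) @^-1` [set a | a <= delta] by [].
apply: closedI; apply: closed_comp; try exact: closed_le.
  move=> z _; apply: cvg_norm; apply: cvgB; [exact: cvg_fst|exact: cvg_cst].
move=> z _; apply: cvg_norm; apply: cvgB; [exact: cvg_snd|exact: cvg_cst].
Qed.

Let h0_gt0 : 0 < h0.
Proof. by rewrite !lt_min ltr01 invr_gt0 !exprn_gt0. Qed.

Let h0P h : 0 < h <= h0 ->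
  [/\ 0 < h, h <= 1, h * M1 ^+ 2 <= 1 & h <= m1 ^+ 2].
Proof.
move=> /andP[hp]; rewrite !le_min => /and3P[h1 hM hm]; split => //.
by rewrite -ler_pdivlMr ?exprn_gt0// div1r.
Qed.

Let S_decay z h : S z -> 0 < h <= h0 ->
  `|(z + h *: f z).1 - y| <= (1 - 2^-1 * h) * `|z.1 - y|.
Proof.
move=> Sz /h0P[hp h1 _ _]; have [Bz _] := S_G Sz; case: Sz => zy zA.
by apply: (newton_step_contracts Bz zy zA rho_small delta_small); rewrite hp.
Qed.

(** The second component is kept at distance [delta] because the forcing term
    [h * (M1 * M2 * m1) * rho] is at most what the contraction gains,
    [h / (2 * m1 ^+ 2) * delta]: this is the hypothesis [rho_delta]. *)
Let S_step z h : S z -> 0 < h <= h0 -> S (z + h *: f z).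
Proof.
move=> Sz hh; have [hp h1 hM hm] := h0P hh; have [Bz _] := S_G Sz.
have [zy zA] := Sz; split.
  rewrite (le_trans (S_decay Sz hh))// (le_trans _ zy)// ler_piMl//.
  by rewrite lerBlDr lerDl mulr_ge0// ltW.
apply: le_trans (inverse_step_estimate z.2 Bz hp hM hm) _.
have q0 : 0 <= 1 - h / (2 * m1 ^+ 2).
  have m12 : 0 < m1 ^+ 2 by rewrite exprn_gt0.
  rewrite subr_ge0 ler_pdivrMr ?mulr_gt0// mul1r (le_trans hm)//.
  by rewrite ler_peMl ?ler1n// ltW.
apply: (le_trans (lerD (ler_wpM2l q0 zA) _)).
  rewrite -mulrA; apply: (ler_wpM2l (ltW hp)); apply: le_trans rho_delta.
  by rewrite ler_wpM2l// !mulr_ge0// ltW.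
by rewrite le_eqVlt; apply/orP; left; apply/eqP; ring.
Qed.

Let cauchy_tangent u Q : cauchy_solution dot F u0 Q0 u Q ->
  forall t, 0 <= t ->
    tangent_within [set s | 0 <= s] (fun s => (u s, Q s)) t (f (u t, Q t)).
Proof.
move=> [_ _ uQ] t t0; have [_ ut Qt] := uQ t t0.
by apply: tangent_within_pair; exact: tderiv_tangent.
Qed.

Theorem newton_flow : exists (u : R -> H) (Q : R -> 'B(H)),
  [/\ cauchy_solution dot F u0 Q0 u Q,
      (forall (v : R -> H) (P : R -> 'B(H)),
         cauchy_solution dot F u0 Q0 v P ->
         forall t : R, 0 <= t -> v t = u t /\ P t = Q t) &
      exp_cvg u y].
Proof.
have N0 : 0 <= N by rewrite !addr_ge0// ltW.
have r0 := ltW r_gt0; have M10 := ltW M1_gt0; have M20 := ltW M2_gt0.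
have [M [M0 fM]] : exists M, 0 <= M /\ forall z, S z -> `|f z| <= M.
  exists (M1 * (2 * r) * N + (M1 * M1 * N + M1)); split.
    by rewrite !addr_ge0// !mulr_ge0.
  by move=> z /S_G; exact: newton_field_bounded.
have [L [L0 fL]] : exists L, 0 <= L /\
    forall z w, G z -> G w -> `|f z - f w| <= L * `|z - w|.
  eexists; split; last by move=> z w; exact: newton_field_lipschitz.
  by rewrite !addr_ge0// !mulr_ge0.
have fLS z w : S z -> S w -> `|f z - f w| <= L * `|z - w|.
  by move=> /S_G Gz /S_G Gw; exact: fL.
have Sz0 : S (u0, Q0) by [].
have [x [x0 Sx xlim xC]] :=
  polygon_limit S_closed S_step fLS fM L0 M0 h0_gt0 Sz0.
pose u t := (x t).1; pose Q t := (x t).2.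
have uQ : cauchy_solution dot F u0 Q0 u Q.
  split; [by rewrite /u x0|by rewrite /Q x0|] => t t0 A T.
  have [But _] := S_G (Sx t t0).
  split; first exact: (F_diff But).1.
    apply: (@quadratic_tderiv _ _ _ _ (2 * L * M)) => s s0.
    by apply: le_trans (xC s t s0 t0); rewrite prod_normE le_max lexx.
  apply: (@quadratic_tderiv _ _ _ _ (2 * L * M)) => s s0.
  by apply: le_trans (xC s t s0 t0); rewrite prod_normE le_max lexx orbT.
exists u, Q; split => //.
- move=> v P vP t t0.
  have rad0 : 0 < Num.min (r / 2) 1 by rewrite lt_min divr_gt0/=.
  have : (v t, P t) = (u t, Q t).
    apply: (@ode_unique _ _ f G L (Num.min (r / 2) 1) (fun t => (u t, Q t))
      (fun t => (v t, P t)) L0 rad0 fL) => //.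
    + move=> s w s0; rewrite /u /Q -surjective_pairing; apply: G_near.
      exact: Sx.
    + exact: cauchy_tangent.
    + exact: cauchy_tangent.
    + by have [-> -> _] := vP; have [-> -> _] := uQ.
  by case=> -> ->.
- exists (expR (2^-1 * h0) * rho), 2^-1; split => //.
    by rewrite mulr_gt0// expR_gt0.
  move=> t t0.
  have c : `|(polygon f h0 n (u0, Q0) t).1 - y| @[n --> \oo] --> `|u t - y|.
    apply: cvg_norm; apply: cvgB; last exact: cvg_cst.
    by apply: (cvg_comp _ _ (xlim t t0)); exact: cvg_fst.
  apply: (cvgr_to_le c); apply: nearW => n.
  have dec :=
    @polygon_decay R _ f S h0 S_step h0_gt0 (fun z => `|z.1 - y|) 2^-1.
  have half0 : 0 <= 2^-1 :> R by rewrite invr_ge0.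
  have := dec half0 (fun z => normr_ge0 _) S_decay (u0, Q0) t n Sz0 t0.
  move=> /le_trans; apply.
  have -> : expR (2^-1 * h0) * rho * expR (- 2^-1 * t) =
      expR (- 2^-1 * (t - h0)) * rho.
    by rewrite mulrAC -expRD; congr (expR _ * _); ring.
  by rewrite ler_wpM2l// expR_ge0.
Qed.

End NewtonFlow.

(** The bound [1 + g * t <= expR (g * t)] is enough. *)
Lemma exp_cvg_cvg (R : realType) (V : normedModType R) (u : R -> V) (y : V) :
  exp_cvg u y -> u t @[t --> +oo] --> y.
Proof.
move=> [C [g [C0 g0 uC]]]; apply/cvgrPdist_le => e e0.
near=> t.
have t0 : 0 <= t by near: t; apply: nbhs_pinfty_ge; rewrite num_real.
have tC : C / (g * e) <= t by near: t; apply: nbhs_pinfty_ge; rewrite num_real.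
rewrite distrC (le_trans (uC t t0))// mulNr expRN.
rewrite ler_pdivrMr ?expR_gt0//.
apply: (@le_trans _ _ (e * (1 + g * t))); last first.
  by rewrite ler_wpM2l ?(ltW e0)// expR_ge1Dx.
rewrite mulrDr mulr1 ler_wpDl ?(ltW e0)//.
by move: tC; rewrite ler_pdivrMr ?mulr_gt0// mulrCA mulrA mulrC (mulrC e).
Unshelve. all: by end_near. Qed.

Theorem theorem6p2 (R : realType) (H : completeNormedModType R)
    (dot : {dot H for idfun}) (dot_norm : forall x : H, dot x x = `|x| ^+ 2)
    (F : H -> H) (y : H) (Fy0 : F y = 0)
    (r M1 M2 m1 : R) (r_gt0 : 0 < r) (M1_gt0 : 0 < M1) (M2_gt0 : 0 < M2)
    (m1_gt0 : 0 < m1) :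
  exists2 eta : R, 0 < eta &
  forall (u0 : H) (Q0 : 'B(H)),
    let B := cball u0 r in
    let F' := fderiv F in
    let F'' := fderiv_within B F' in
    B y ->
    (forall u, B u -> differentiable F u /\ differentiable_within B F' u) ->
    (forall u, B u -> `|F' u| <= M1 /\ `|F'' u| <= M2) ->
    (forall u, B u -> boundedly_invertible (F' u) /\ `|bop_inv (F' u)| <= m1) ->
    `|u0 - y| <= eta ->
    `|Q0 - bop_inv (F' y)| <= eta ->
    exists (u : R -> H) (Q : R -> 'B(H)),
      [/\ cauchy_solution dot F u0 Q0 u Q,
          (forall (v : R -> H) (P : R -> 'B(H)),
             cauchy_solution dot F u0 Q0 v P ->
             forall t : R, 0 <= t -> v t = u t /\ P t = Q t),
          cvg (u t @[t --> +oo]),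
          F (lim (u t @[t --> +oo])) = 0 &
          exp_cvg u y].
Proof.
(* [delta] makes [V (F u)] at most a quarter of [|w|]; then [rho] does the same
   for the Taylor remainder, keeps [u] within [r / 2] of [u0], and keeps the
   forcing of the equation for [V] below its damping at [|V| = delta]. *)
pose delta := 4^-1 / M1.
have delta0 : 0 < delta by rewrite divr_gt0.
pose rho := Num.min (r / 4) (Num.min (4^-1 / (m1 * M2))
  (delta / (2 * m1 ^+ 2) / (M1 * M2 * m1))).
have m12 : 0 < m1 ^+ 2 by rewrite exprn_gt0.
have rho0 : 0 < rho by rewrite !lt_min !divr_gt0 ?mulr_gt0.
have rho1 : rho <= r / 4 by rewrite ge_min lexx.
have rho2 : m1 * M2 * rho <= 4^-1.
  by rewrite mulrC -ler_pdivlMr ?mulr_gt0// !ge_min lexx !orbT.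
have rho3 : M1 * M2 * m1 * rho <= delta / (2 * m1 ^+ 2).
  by rewrite mulrC -ler_pdivlMr ?mulr_gt0// !ge_min lexx !orbT.
have delta4 : M1 * delta <= 4^-1 by rewrite mulrC divfK ?gt_eqF.
exists (Num.min rho delta); first by rewrite lt_min rho0.
move=> u0 Q0 B F' F'' By F_diff F_bnd F_inv.
move=> u0eta Q0eta.
have u0y : `|u0 - y| <= rho by rewrite (le_trans u0eta)// ge_min lexx.
have Q0A : `|Q0 - bop_inv (F' y)| <= delta.
  by rewrite (le_trans Q0eta)// ge_min lexx orbT.
have rho_r : rho + `|u0 - y| <= r / 2 by lra.
have [u [Q [uQ uniq uy]]] := newton_flow dot_norm Fy0 M1_gt0 M2_gt0 m1_gt0 By
  F_diff F_bnd F_inv r_gt0 rho0 (ltW delta0) rho_r rho2 delta4 rho3 u0y Q0A.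
have ucvg := exp_cvg_cvg uy.
exists u, Q; split => //; first by apply/cvg_ex; exists y.
by rewrite (cvg_lim (@norm_hausdorff _ H) ucvg).
Qed.
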